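(* Let $A \in \Omega_n$. If $A$ is not cyclic (i.e. $A$ is derogatory), then there exists a matrix $B\in \Omega_n$ such that the function $l_{\Omega_n}(\cdot,B):\Omega_n\to[0,1)$ is not continuous at $A$.
   Context: $\mathbb D$ is the open unit disk in $\mathbb C$. $\mathcal M_n$ is the set of all $n\times n$ complex matrices; $r(A)$ is the spectral radius of $A$. The spectral ball is $\Omega_n=\{A\in\mathcal M_n: r(A)<1\}$. A matrix $A\in\mathcal M_n$ is cyclic (non-derogatory) if it admits a cyclic vector, i.e. there is $v\in\mathbb C^n$ such that $v, Av,\dots,A^{n-1}v$ span $\mathbb C^n$. For a domain $D\subset\mathbb C^m$ and $z,w\in D$, the Lempert function is $$l_D(z,w):=\inf\{|\alpha|:\alpha\in\mathbb D \text{ and } \exists\,\varphi\in\mathcal O(\mathbb D,D):\varphi(0)=z,\ \varphi(\alpha)=w\},$$ where $\mathcal O(\mathbb D,D)$ is the set of holomorphic maps from $\mathbb D$ to $D$. *)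

(* Defs.v *)
From HB Require Import structures.
From mathcomp Require Import all_boot all_order all_algebra.
From mathcomp Require Import all_classical all_reals all_analysis.
From mathcomp.real_closed Require Import complex.
Set Implicit Arguments.
Unset Strict Implicit.
Unset Printing Implicit Defensive.
Import Order.TTheory GRing.Theory Num.Theory.
Import numFieldNormedType.Exports.
Local Open Scope classical_set_scope.
Local Open Scope ring_scope.
Local Open Scope complex_scope.

(* The complex field over [R] is [R[i]]; it receives here the topology of its
   modulus, as a normed space over itself. The matrix spaces ['M[R[i]]_n] then
   carry the library's (sup norm) structure of normed space over [R[i]]. *)
HB.instance Definition _ (R : rcfType) := NormedModule.copy R[i] R[i]^o.

(* The norm [`|z|] of [R[i]] takes its values in [R[i]]; [Normc.normc z] is the
   same modulus as an element of [R], and [`|z|] is [(Normc.normc z)%:C]. *)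

Definition unit_disk (R : realType) : set R[i] := [set z | `|z| < 1].

(* Holomorphic maps from the unit disk to [D] are represented by total
   functions; their values outside the disk are irrelevant. Differentiability
   is complex, since the scalars of [V] are [R[i]]. *)
Definition holo_disk (R : realType) (V : normedModType R[i]) (D : set V)
    (phi : R[i] -> V) : Prop :=
  (forall z, unit_disk z -> derivable phi z 1) /\
  (forall z, unit_disk z -> D (phi z)).

(* The infimum is over a nonempty set when [D] is a domain containing [z] and
   [w]; [inf] would otherwise return the dummy value 0. *)
Definition lempert (R : realType) (V : normedModType R[i]) (D : set V)
    (z w : V) : R :=
  inf [set Normc.normc a | a in [set a : R[i] | unit_disk a /\
    exists phi, [/\ holo_disk D phi, phi 0 = z & phi a = w]]].

Definition spectral_radius (R : realType) (n : nat) (A : 'M[R[i]]_n) : R :=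
  sup [set Normc.normc l | l in [set l : R[i] | eigenvalue A l]].

Definition spectral_ball (R : realType) (n : nat) : set 'M[R[i]]_n :=
  [set A | spectral_radius A < 1].
Arguments spectral_ball : clear implicits.

Definition cyclic_mx (R : realType) (n : nat) (A : 'M[R[i]]_n) : Prop :=
  exists v : 'cV[R[i]]_n,
    (<<mkseq (fun k => A ^+ k *m v) n>> = fullv)%VS.

(* Main.v *)
(* Since [A] is derogatory, some eigenvalue [l] has [rank (A - l) <= n - 2]. Hence
   for every disc [phi] with [phi 0 = A] the function [det (l - phi z)], which is
   bounded by [2 ^ n], vanishes to second order at [0], and Cauchy's estimate gives
   [|det (l - B)| <= K |z|^2] whenever [phi z = B]: this bounds the Lempert
   function at [A] from below by the square root of [|det (l - B)| / K].
   On the other hand [A] is a limit of matrices [X] with the same spectrum that are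
   conjugate to a bidiagonal cyclic matrix [J]. Changing the corner entry of [J]
   linearly in [z], and deforming the conjugating matrix holomorphically to the
   identity, gives discs which reach one fixed [B], with [|det (l - B)| = t e] for a
   fixed [e], from every such [X] at the parameter [t]. As [t] is small compared
   with the square root of [t e / K], the Lempert function jumps at [A]. *)
Require Import Defs.
From HB Require Import structures.
From mathcomp Require Import all_boot all_order all_algebra.
From mathcomp Require Import all_classical all_reals all_analysis.
From mathcomp.real_closed Require Import complex.
From mathcomp Require Import perm ring lra zify.
Import Order.TTheory GRing.Theory Num.Theory.
Import numFieldNormedType.Exports.
Local Open Scope classical_set_scope.
Local Open Scope ring_scope.
Local Open Scope complex_scope.
Set Implicit Arguments.
Unset Strict Implicit.
Unset Printing Implicit Defensive.

(** The point [B] must be fixed before the approximants of [A] are known, whereas the matrix [T]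
    conjugating an approximant to bidiagonal form depends on it and comes with no bound. So every
    disc has to undo an arbitrary [T] within the same parameter distance [t]. Interpolating affinely
    between [T] and the identity may pass through singular matrices; writing the diagonal entries as
    high powers of numbers close to 1 and interpolating these numbers instead keeps the path
    invertible on the whole disc. This works entry by entry because everything stays lower
    triangular: [A] through its Schur form, [T] because its columns are Newton vectors of a
    triangular matrix. The gap is between a linear and a quadratic quantity: the determinant at [B]
    has modulus [t * d ^+ n], and a disc from [A] reaching [B] at a parameter below [2 * t] allows
    less than [K * (2 * t) ^+ 2], which [t] is chosen to make too small. Crude constants suffice for
    this, so Cauchy's estimate is derived on squares, from Goursat's theorem. *)

Local Notation Re := complex.Re.
Local Notation Im := complex.Im.

Import Normc.

(** * The modulus as a real number *)

Section Modulus.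
Variable R : realType.
Implicit Types (x y z : R[i]) (r e : R).

Lemma normc_normrE z : `|z| = (normc z)%:C.
Proof. by case: z => a b; rewrite normc_def. Qed.

Lemma normc_ge0 z : 0 <= normc z.
Proof. by case: z => a b; exact: sqrtr_ge0. Qed.

Lemma normc_gt0 z : (0 < normc z) = (z != 0).
Proof. by rewrite -ltcR -normc_normrE normr_gt0. Qed.

Lemma normc_real r : normc r%:C = `|r|.
Proof. by rewrite /normc /= expr0n addr0 sqrtr_sqr. Qed.

Lemma normc_nat n : normc (n%:R : R[i]) = n%:R.
Proof. by apply: complexI; rewrite -normc_normrE normr_nat rmorph_nat. Qed.

Lemma normc_i : normc ('i : R[i]) = 1.
Proof. by rewrite /normc /= expr0n add0r expr1n sqrtr1. Qed.

Lemma normcX z n : normc (z ^+ n) = normc z ^+ n.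
Proof.
elim: n => [|n IH]; first by rewrite !expr0 normc1.
by rewrite !exprS normcM IH.
Qed.

Lemma le_normcB x y : normc (x - y) <= normc x + normc y.
Proof. by rewrite -(normcN y) le_normcD. Qed.

Lemma normc_dist x y : normc (x - y) = normc (y - x).
Proof. by rewrite -normcN opprB. Qed.

Lemma le_normcB_l x y : normc x - normc y <= normc (x - y).
Proof. by rewrite lerBlDr -{1}(subrK y x) le_normcD. Qed.

Lemma ler_norm_Re z : `|Re z| <= normc z.
Proof.
case: z => a b /=; rewrite -sqrtr_sqr ler_sqrt ?lerDl ?sqr_ge0 //.
by rewrite addr_ge0 ?sqr_ge0.
Qed.

Lemma ler_norm_Im z : `|Im z| <= normc z.
Proof.
case: z => a b /=; rewrite -sqrtr_sqr ler_sqrt ?lerDr ?sqr_ge0 //.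
by rewrite addr_ge0 ?sqr_ge0.
Qed.

Lemma normc_le_ReIm z : normc z <= `|Re z| + `|Im z|.
Proof.
have -> : z = (Re z)%:C + 'i * (Im z)%:C by rewrite -complexE.
rewrite (le_trans (le_normcD _ _)) // normcM normc_i mul1r !normc_real.
by rewrite -complexE.
Qed.

Lemma normc_prod (I : Type) (s : seq I) (P : pred I) (F : I -> R[i]) :
  normc (\prod_(i <- s | P i) F i) = \prod_(i <- s | P i) normc (F i).
Proof. by apply: (big_morph _ (@normcM R)); rewrite normc1. Qed.

Lemma normc_sum (I : Type) (s : seq I) (P : pred I) (F : I -> R[i]) :
  normc (\sum_(i <- s | P i) F i) <= \sum_(i <- s | P i) normc (F i).
Proof.
elim/big_rec2: _ => [|i y x _ xy]; first by rewrite normc0.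
by rewrite (le_trans (le_normcD _ _)) ?lerD2l.
Qed.

Lemma unit_diskE z : unit_disk z = (normc z < 1) :> Prop.
Proof. by rewrite /unit_disk /= normc_normrE -ltcR. Qed.

End Modulus.


(** * Entrywise differentiability of matrix functions *)

Section MatrixDerivable.

Lemma mx_norm_leP (K : numDomainType) m n (M : 'M[K]_(m, n)) (e : K) :
  0 <= e -> reflect (forall i j, `|M i j| <= e) (`|M| <= e).
Proof.
move=> /nonnegP[{}e]; rewrite [X in X <= _]/Num.Def.normr /= mx_normE num_le.
apply: (iffP idP) => [/bigmax_leP[_ H] i j|H]; first exact: (H (i, j) isT).
have e0 : 0 <= e%:num by [].
by apply/bigmax_leP; split=> [|[i j] _]; [exact: e0 | exact: H].
Qed.

(* [derivable_mxP] of the library requires a [realFieldType]. *)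
Lemma derivable_entriesP (K : numFieldType) (V : normedModType K) m n
    (F : V -> 'M[K]_(m, n)) t v :
  derivable F t v <-> forall i j, derivable (fun x => F x i j : K) t v.
Proof.
split=> [/cvg_ex[/= l /cvgrPdist_le Fl] i j|H]; apply/cvg_ex.
  exists (l i j); apply/cvgrPdist_le => /= e e0.
  near=> x; have /mx_norm_leP : `|l - x^-1 *: (F (x *: v + t) - F t)| <= e.
    by near: x; exact: Fl.
  by move=> /(_ (ltW e0) i j); rewrite !mxE.
exists (\matrix_(i, j) sval (cid ((cvg_ex _).1 (H i j)))).
apply/cvgrPdist_le => /= e e0; near=> x; apply/mx_norm_leP; first exact: ltW.
move=> i j; rewrite !mxE /=; move: i j; near: x.
apply: filter_forall => i; apply: filter_forall => j.
exact: ((cvgrPdist_le _ _).1 (svalP (cid ((cvg_ex _).1 (H i j))))).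
Unshelve. all: by end_near. Qed.

End MatrixDerivable.

(** * Complex differentiability with real estimates *)

Section ComplexDifferentiability.
Variable R : realType.
Implicit Types (f g : R[i] -> R[i]) (z h d : R[i]).

(** The difference quotient is cleared, so [h = 0] needs no exception and every bound is an
    inequality in [R]. *)
Definition cdiff f z := exists d, forall e : R, 0 < e ->
  exists2 r : R, 0 < r &
    forall h, normc h < r -> normc (f (z + h) - f z - d * h) <= e * normc h.

Lemma derivable_cdiff f z : derivable f z 1 -> cdiff f z.
Proof.
move=> /cvg_ex[/= l /cvgrPdist_le Fl]; exists l => e e0.
have e0' : 0 < e%:C by rewrite ltcR.
have [/= d d0 dF] := Fl _ e0'.
have [r dE] : exists r, d = r%:C.
  by exists (Re d); rewrite RRe_real // gtr0_real.
rewrite {}dE in d0 dF; exists r; first by rewrite ltcR in d0.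
move=> h hr; have [->|h0] := eqVneq h 0.
  by rewrite addr0 mulr0 subrr subr0 normc0 mulr0.
have := dF h _ h0; rewrite /ball_ /= sub0r normrN normc_normrE ltcR => /(_ hr).
rewrite [h *: 1]mulr1 normc_normrE lecR => H.
have -> : f (z + h) - f z - l * h = - ((l - h^-1 * (f (h + z) - f z)) * h).
  by rewrite [h + z]addrC; field.
by rewrite normcN normcM ler_wpM2r ?normc_ge0.
Qed.

Lemma cdiff_cvg f z (e : R) : cdiff f z -> 0 < e ->
  exists2 r : R, 0 < r & forall h, normc h < r -> normc (f (z + h) - f z) <= e.
Proof.
move=> [d fd] e0; have [r r0 H] := fd 1 ltr01.
have d1 : 0 < normc d + 1 by rewrite ltr_wpDl ?normc_ge0.
exists (Num.min r (e / (normc d + 1))); first by rewrite lt_min r0 divr_gt0.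
move=> h; rewrite lt_min => /andP[hr he].
rewrite -[f _ - _](subrK (d * h)) (le_trans (le_normcD _ _)) //.
rewrite normcM (le_trans (lerD (H _ hr) (lexx _))) // -mulrDl addrC mulrC.
by rewrite -ler_pdivlMr // ltW.
Qed.

Lemma derivableMc f g z : derivable f z 1 -> derivable g z 1 ->
  derivable (fun x => f x * g x) z 1.
Proof. exact: derivableM. Qed.

Lemma derivableBc f g z : derivable f z 1 -> derivable g z 1 ->
  derivable (fun x => f x - g x) z 1.
Proof. exact: derivableB. Qed.

Lemma derivableDc f g z : derivable f z 1 -> derivable g z 1 ->
  derivable (fun x => f x + g x) z 1.
Proof. exact: derivableD. Qed.

Lemma derivable_cstc (c : R[i]) z : derivable (fun=> c : R[i]) z 1.
Proof. exact: derivable_cst. Qed.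

Lemma derivable_idc z : derivable (fun x : R[i] => x) z 1.
Proof. exact: derivable_id. Qed.

Lemma derivableVc f z : f z != 0 -> derivable f z 1 ->
  derivable (fun x => (f x)^-1) z 1.
Proof. exact: derivableV. Qed.

Lemma derivableNc f z : derivable f z 1 -> derivable (fun x => - f x) z 1.
Proof. exact: derivableN. Qed.

End ComplexDifferentiability.

(** * Integrals of complex functions over real segments *)

Section ComplexIntegral.
Variable R : realType.
Implicit Types (f g : R -> R[i]) (a b c t e : R).
Let mu := @lebesgue_measure R.

Definition ccont f t := forall e : R, 0 < e ->
  exists2 r : R, 0 < r & forall s, `|s| < r -> normc (f (t + s) - f t) <= e.

Definition ccont_on a b f := forall t, a <= t <= b -> ccont f t.

Definition cint a b f : R[i] :=
  Complex (\int[mu]_(t in `[a, b]) Re (f t)) (\int[mu]_(t in `[a, b]) Im (f t)).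

Lemma ccontD f g t : ccont f t -> ccont g t -> ccont (fun x => f x + g x) t.
Proof.
move=> cf cg e e0; have e2 : 0 < e / 2 by rewrite divr_gt0.
have [r r0 fr] := cf _ e2; have [s s0 gs] := cg _ e2.
exists (Num.min r s); first by rewrite lt_min r0.
move=> x; rewrite lt_min => /andP[/fr fx /gs gx].
have -> : f (t + x) + g (t + x) - (f t + g t) =
  (f (t + x) - f t) + (g (t + x) - g t) by ring.
by rewrite (le_trans (le_normcD _ _)) // (splitr e) lerD.
Qed.


Lemma ccontZ (c : R[i]) f t : ccont f t -> ccont (fun x => c * f x) t.
Proof.
move=> cf e e0; have c1 : 0 < normc c + 1 by rewrite ltr_wpDl ?normc_ge0.
have [r r0 fr] := cf (e / (normc c + 1)) ltac:(by rewrite divr_gt0).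
exists r => // x /fr; rewrite -mulrBr normcM ler_pdivlMr // => H.
by apply: le_trans H; rewrite mulrC ler_wpM2l ?normc_ge0 // lerDl.
Qed.

Lemma ccontB f g t : ccont f t -> ccont g t -> ccont (fun x => f x - g x) t.
Proof.
move=> cf cg; have := ccontD cf (ccontZ (-1) cg).
by under eq_fun do rewrite mulN1r.
Qed.

(** Here [p] stands for [Re] or [Im]: both are additive and 1-Lipschitz, so they preserve
    continuity, and a continuous function on a segment is integrable. *)
Lemma ccont_part (p : R[i] -> R) a b f :
  (forall x y, p (x - y) = p x - p y) -> (forall x, `|p x| <= normc x) ->
  ccont_on a b f -> mu.-integrable `[a, b] (EFin \o (fun t => p (f t))).
Proof.
move=> pB p_le cf; apply: continuous_compact_integrable; first exact: segment_compact.
apply: continuous_in_subspaceT => t; rewrite inE /= in_itv /= => /cf ct.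
apply/cvgrPdist_le => /= e e0; have [r r0 H] := ct _ e0.
exists r => //= x; rewrite /ball_ /= => xr.
rewrite -pB (le_trans (p_le _)) // normc_dist -{1}(subrK t x) [x - t + t]addrC.
by apply: H; rewrite distrC.
Qed.

Lemma integrable_Re a b f : ccont_on a b f ->
  mu.-integrable `[a, b] (EFin \o (fun t => Re (f t))).
Proof.
move=> cf; apply: (@ccont_part (@Re R) a b f _ _ cf) => [[? ?] [? ?] //|z].
exact: ler_norm_Re.
Qed.

Lemma integrable_Im a b f : ccont_on a b f ->
  mu.-integrable `[a, b] (EFin \o (fun t => Im (f t))).
Proof.
move=> cf; apply: (@ccont_part (@Im R) a b f _ _ cf) => [[? ?] [? ?] //|z].
exact: ler_norm_Im.
Qed.

Lemma cint_split a b c f : a <= c -> c <= b -> ccont_on a b f ->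
  cint a b f = cint a c f + cint c b f.
Proof.
move=> ac cb cf.
have H (h : R -> R) : mu.-integrable `[a, b] (EFin \o h) ->
    \int[mu]_(t in `[a, b]) h t =
    \int[mu]_(t in `[a, c]) h t + \int[mu]_(t in `[c, b]) h t.
  move=> ih; have := @Rintegral_itvB R h (BLeft a) (BRight b) c ih.
  rewrite !bnd_simp => /(_ ac cb) /eqP; rewrite subr_eq addrC => /eqP ->.
  congr (_ + _); apply: Rintegral_itv_obnd_cbnd.
  apply: integrableS ih => //; apply: subset_itv; rewrite ?bnd_simp //.
rewrite /cint (H _ (integrable_Re cf)) (H _ (integrable_Im cf)).
by [].
Qed.

Lemma cintD a b f g : ccont_on a b f -> ccont_on a b g ->
  cint a b (fun t => f t + g t) = cint a b f + cint a b g.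
Proof.
move=> cf cg; rewrite /cint.
have -> : (fun t => Re (f t + g t)) = (fun t => Re (f t) + Re (g t)).
  by apply/funext => t; case: (f t) (g t) => ? ? [].
have -> : (fun t => Im (f t + g t)) = (fun t => Im (f t) + Im (g t)).
  by apply/funext => t; case: (f t) (g t) => ? ? [].
rewrite (RintegralD _ (integrable_Re cf) (integrable_Re cg)) //.
by rewrite (RintegralD _ (integrable_Im cf) (integrable_Im cg)).
Qed.

Lemma cintZ a b (c : R[i]) f : ccont_on a b f ->
  cint a b (fun t => c * f t) = c * cint a b f.
Proof.
case: c => u v cf; rewrite /cint.
have rf := integrable_Re cf; have jf := integrable_Im cf.
have Z (w : R) (h : R -> R) : mu.-integrable `[a, b] (EFin \o h) ->
    mu.-integrable `[a, b] (EFin \o (fun t => w * h t)).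
  by move=> ih; exact: (@integrableZl _ _ _ mu _ (measurable_itv `[a, b]) w _ ih).
have -> : (fun t => Re ((u +i* v) * f t)) = (fun t => u * Re (f t) - v * Im (f t)).
  by apply/funext => t; case: (f t).
have -> : (fun t => Im ((u +i* v) * f t)) = (fun t => u * Im (f t) + v * Re (f t)).
  by apply/funext => t; case: (f t).
rewrite (RintegralB _ (Z _ _ rf) (Z _ _ jf)) // (RintegralD _ (Z _ _ jf) (Z _ _ rf)) //.
rewrite !RintegralZl //.
Qed.

Lemma cintB a b f g : ccont_on a b f -> ccont_on a b g ->
  cint a b (fun t => f t - g t) = cint a b f - cint a b g.
Proof.
move=> cf cg; rewrite -mulN1r -cintZ // -cintD //; last first.
  by move=> t /cg /ccontZ; exact.
by congr (cint a b _); apply/funext => t; rewrite mulN1r.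
Qed.

Lemma eq_cint a b f g : (forall t, a <= t <= b -> f t = g t) ->
  cint a b f = cint a b g.
Proof.
move=> fg; rewrite /cint; congr Complex; apply: eq_Rintegral => t;
  by rewrite inE /= in_itv /= => /fg ->.
Qed.

Lemma Rintegral_segment_cst a b (c : R) : a <= b ->
  \int[mu]_(t in `[a, b]) c = c * (b - a).
Proof.
move=> ab; rewrite Rintegral_cst //= lebesgue_measure_itv /= lte_fin.
by case: ltgtP ab => // -> _; rewrite subrr.
Qed.

Lemma cint_cst a b (c : R[i]) : a <= b -> cint a b (fun=> c) = c * (b - a)%:C.
Proof.
by move=> ab; rewrite /cint !Rintegral_segment_cst //; case: c => u v; simpc.
Qed.

(** Real and imaginary parts are estimated separately, which costs the factor 2. *)
Lemma normc_cint a b f (M : R) : a <= b -> ccont_on a b f ->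
  (forall t, a <= t <= b -> normc (f t) <= M) ->
  normc (cint a b f) <= 2 * M * (b - a).
Proof.
move=> ab cf fM.
have H (h : R -> R) : mu.-integrable `[a, b] (EFin \o h) ->
    (forall t, a <= t <= b -> `|h t| <= M) ->
    `|\int[mu]_(t in `[a, b]) h t| <= M * (b - a).
  move=> ih hM; rewrite (le_trans (le_normr_Rintegral _ ih)) //.
  rewrite -Rintegral_segment_cst //; apply: le_Rintegral => //.
  - exact: integrable_norm.
  - apply: continuous_compact_integrable; first exact: segment_compact.
    by apply: continuous_subspaceT => t; exact: cvg_cst.
rewrite (le_trans (normc_le_ReIm _)) //= -mulrA mulr_natl mulr2n lerD //.
  by apply: H; [exact: integrable_Re|move=> t /fM; apply: le_trans; exact: ler_norm_Re].
by apply: H; [exact: integrable_Im|move=> t /fM; apply: le_trans; exact: ler_norm_Im].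
Qed.

End ComplexIntegral.

(** * Nested intervals and bisection of a rectangle *)

Section Bisection.
Variable R : realType.

(** The supremum of the left endpoints works, since every right endpoint bounds all of them. *)
Lemma nested_intervals (u v : nat -> R) : (forall n, 0 <= v n) ->
  (forall n, u n <= u n.+1) -> (forall n, u n.+1 + v n.+1 <= u n + v n) ->
  exists p, forall n, u n <= p <= u n + v n.
Proof.
move=> v0 uS uvS.
have um n m : (n <= m)%N -> u n <= u m.
  by apply: (homo_leq (@lexx _ _) (fun _ _ _ => @le_trans _ _ _ _ _)).
have uvm n m : (n <= m)%N -> u m + v m <= u n + v n.
  by apply: (@homo_leq _ (fun n => u n + v n) (fun x y => y <= x)) => // y x z xy yz;
     exact: le_trans yz xy.
have ub n m : u m <= u n + v n.
  have [nm|/ltnW mn] := leqP n m; last by rewrite (le_trans (um _ _ mn)) ?lerDl.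
  by rewrite (le_trans _ (uvm _ _ nm)) ?lerDl.
have ru n : range u (u n) by exists n.
exists (sup (range u)) => n; apply/andP; split.
  by apply: ub_le_sup (ru n); exists (u 0 + v 0) => _ [m _ <-].
by apply: ge_sup; [exists (u 0); exact: (ru 0)|move=> _ [m _ <-]].
Qed.

(** A cell of level [n] is given by its lower left corner, as its sides are [w / 2 ^+ n] and
    [h / 2 ^+ n]. If [G] failed at the root, some child of each bad cell would be bad; the resulting
    nested cells share a point [(p, q)], where the second hypothesis is contradicted. *)
Lemma bisection (w h x0 y0 : R) (G : nat -> R * R -> Prop) : 0 <= w -> 0 <= h ->
  (forall n x y, x0 <= x -> y0 <= y -> x + w / 2 ^+ n <= x0 + w -> y + h / 2 ^+ n <= y0 + h ->
    (forall a b : bool, G n.+1 (x + a%:R * (w / 2 ^+ n.+1), y + b%:R * (h / 2 ^+ n.+1))) ->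
    G n (x, y)) ->
  (forall p q, x0 <= p <= x0 + w -> y0 <= q <= y0 + h -> exists n, forall x y,
    x <= p <= x + w / 2 ^+ n -> y <= q <= y + h / 2 ^+ n ->
    x0 <= x -> y0 <= y -> x + w / 2 ^+ n <= x0 + w -> y + h / 2 ^+ n <= y0 + h ->
    G n (x, y)) ->
  G 0 (x0, y0).
Proof.
move=> w0 h0 Gstep Gloc; apply: contrapT => nG0.
pose inside n (s : R * R) := [/\ x0 <= s.1, y0 <= s.2,
  s.1 + w / 2 ^+ n <= x0 + w & s.2 + h / 2 ^+ n <= y0 + h].
pose child n (s : R * R) (ab : bool * bool) :=
  (s.1 + ab.1%:R * (w / 2 ^+ n.+1), s.2 + ab.2%:R * (h / 2 ^+ n.+1)).
have half (v : R) n : v / 2 ^+ n = v / 2 ^+ n.+1 + v / 2 ^+ n.+1.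
  by rewrite exprS invfM; field; rewrite expf_neq0 // pnatr_eq0.
have v0 (v : R) n : 0 <= v -> 0 <= v / 2 ^+ n by move=> ?; rewrite divr_ge0 ?exprn_ge0.
have wn n := v0 w n w0; have hn n := v0 h n h0.
have stepx (x v : R) n (a : bool) : 0 <= v ->
    x <= x + a%:R * (v / 2 ^+ n.+1) /\
    x + a%:R * (v / 2 ^+ n.+1) + v / 2 ^+ n.+1 <= x + v / 2 ^+ n.
  move=> hv; rewrite (half v n); have := v0 v n.+1 hv.
  by case: a; rewrite ?mul1r ?mul0r; lra.
(* [c] selects a bad child of each bad cell; iterating it gives the sequence [s] below. *)
have [c Hc] : {c & forall ns : nat * (R * R), inside ns.1 ns.2 ->
    ~ G ns.1 ns.2 -> ~ G ns.1.+1 (child ns.1 ns.2 (c ns))}.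
  apply: (@choice _ _ (fun (ns : nat * (R * R)) c => inside ns.1 ns.2 ->
    ~ G ns.1 ns.2 -> ~ G ns.1.+1 (child ns.1 ns.2 c))).
  move=> [n [x y]] /=; apply: contrapT => /forallNP H.
  have [i1 i2 i3 i4] : inside n (x, y).
    by apply: contrapT => ni; apply: (H (true, true)).
  apply: (H (true, true)) => _ nG; case: nG; apply: Gstep => // a b.
  by apply: contrapT => nG; apply: (H (a, b)).
pose s := fix s n := if n is m.+1 then child m (s m) (c (m, s m)) else (x0, y0).
have ins n : inside n (s n) /\ ~ G n (s n).
  elim: n => [|n [IH nG]]; first by split=> //; split; rewrite //= expr0 divr1.
  split; last exact: (Hc (n, s n)).
  case: IH => i1 i2 i3 i4.
  have [a1 a2] := stepx (s n).1 w n (c (n, s n)).1 w0.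
  have [b1 b2] := stepx (s n).2 h n (c (n, s n)).2 h0.
  split => /=; [exact: le_trans a1|exact: le_trans b1|exact: le_trans a2 i3|exact: le_trans b2 i4].
have [p Hp] := @nested_intervals (fun n => (s n).1) (fun n => w / 2 ^+ n) wn
  (fun n => (stepx _ _ _ _ w0).1) (fun n => (stepx _ _ _ _ w0).2).
have [q Hq] := @nested_intervals (fun n => (s n).2) (fun n => h / 2 ^+ n) hn
  (fun n => (stepx _ _ _ _ h0).1) (fun n => (stepx _ _ _ _ h0).2).
have := Hp 0%N; have := Hq 0%N; rewrite /= expr0 !divr1 => Hq0 Hp0.
have [n Hn] := Gloc p q Hp0 Hq0; have [[i1 i2 i3 i4] nG] := ins n.
by apply: nG; move: (Hn (s n).1 (s n).2 (Hp n) (Hq n) i1 i2 i3 i4); case: (s n).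
Qed.

End Bisection.

(** * Integrals along the boundary of a rectangle *)

Section RectangleIntegral.
Variable R : realType.
Implicit Types (k l : R[i] -> R[i]) (x y : R) (z p : R[i]).

(* Minus the contour integral of [k] around the rectangle. *)
Definition rint k x1 x2 y1 y2 : R[i] :=
  cint x1 x2 (fun x => k (x +i* y2) - k (x +i* y1)) -
  'i * cint y1 y2 (fun y => k (x2 +i* y) - k (x1 +i* y)).

Definition hline k x1 x2 y := ccont_on x1 x2 (fun x => k (x +i* y)).
Definition vline k y1 y2 x := ccont_on y1 y2 (fun y => k (x +i* y)).

Definition bcont k x1 x2 y1 y2 :=
  [/\ hline k x1 x2 y1, hline k x1 x2 y2, vline k y1 y2 x1 & vline k y1 y2 x2].

Lemma cdiff_hcont k x y : cdiff k (x +i* y) -> ccont (fun t => k (t +i* y)) x.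
Proof.
move=> kd e e0; have [r r0 H] := cdiff_cvg kd e0; exists r => // s sr.
have -> : (x + s) +i* y = (x +i* y) + s%:C by simpc.
by apply: H; rewrite normc_real.
Qed.

Lemma cdiff_vcont k x y : cdiff k (x +i* y) -> ccont (fun t => k (x +i* t)) y.
Proof.
move=> kd e e0; have [r r0 H] := cdiff_cvg kd e0; exists r => // s sr.
have -> : x +i* (y + s) = (x +i* y) + 'i * s%:C by simpc.
by apply: H; rewrite normcM normc_i mul1r normc_real.
Qed.

Lemma rint_splitx k x1 c x2 y1 y2 : x1 <= c -> c <= x2 ->
  bcont k x1 x2 y1 y2 -> vline k y1 y2 c ->
  rint k x1 x2 y1 y2 = rint k x1 c y1 y2 + rint k c x2 y1 y2.
Proof.
move=> xc cx [h1 h2 v1 v2] vc; rewrite /rint (cint_split xc cx); last first.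
  by move=> t tx; apply: ccontB; [exact: h2|exact: h1].
by rewrite (cintB vc v1) (cintB v2 v1) (cintB v2 vc); ring.
Qed.

Lemma rint_splity k x1 x2 y1 c y2 : y1 <= c -> c <= y2 ->
  bcont k x1 x2 y1 y2 -> hline k x1 x2 c ->
  rint k x1 x2 y1 y2 = rint k x1 x2 y1 c + rint k x1 x2 c y2.
Proof.
move=> yc cy [h1 h2 v1 v2] hc; rewrite /rint (cint_split yc cy); last first.
  by move=> t ty; apply: ccontB; [exact: v2|exact: v1].
by rewrite (cintB hc h1) (cintB h2 h1) (cintB h2 hc); ring.
Qed.

Definition on_bdry x1 x2 y1 y2 (P : R[i] -> Prop) :=
  (forall x, x1 <= x <= x2 -> P (x +i* y1) /\ P (x +i* y2)) /\
  (forall y, y1 <= y <= y2 -> P (x1 +i* y) /\ P (x2 +i* y)).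

Lemma eq_rint k l x1 x2 y1 y2 : on_bdry x1 x2 y1 y2 (fun z => k z = l z) ->
  rint k x1 x2 y1 y2 = rint l x1 x2 y1 y2.
Proof.
move=> [hx hy]; rewrite /rint; congr (_ - _ * _); apply: eq_cint => t.
  by move=> /hx[-> ->].
by move=> /hy[-> ->].
Qed.

Lemma rintB k l x1 x2 y1 y2 : bcont k x1 x2 y1 y2 -> bcont l x1 x2 y1 y2 ->
  rint (fun z => k z - l z) x1 x2 y1 y2 = rint k x1 x2 y1 y2 - rint l x1 x2 y1 y2.
Proof.
move=> [h1 h2 v1 v2] [h1' h2' v1' v2']; rewrite /rint.
have hB (f g : R -> R[i]) a b : ccont_on a b f -> ccont_on a b g ->
    ccont_on a b (fun t => f t - g t).
  by move=> cf cg t tab; apply: ccontB; [exact: cf|exact: cg].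
rewrite (cintB (hB _ _ _ _ h2 h2') (hB _ _ _ _ h1 h1')).
rewrite (cintB (hB _ _ _ _ v2 v2') (hB _ _ _ _ v1 v1')).
by rewrite (cintB h2 h2') (cintB h1 h1') (cintB h2 h1) (cintB h2' h1')
  (cintB v2 v2') (cintB v1 v1') (cintB v2 v1) (cintB v2' v1'); ring.
Qed.

Lemma rintZ k (c : R[i]) x1 x2 y1 y2 : bcont k x1 x2 y1 y2 ->
  rint (fun z => c * k z) x1 x2 y1 y2 = c * rint k x1 x2 y1 y2.
Proof.
move=> [h1 h2 v1 v2]; rewrite /rint mulrBr mulrCA -!(cintZ c).
- by congr (_ - _ * _); apply: eq_cint => t _; rewrite mulrBr.
- by move=> t ty; apply: ccontB; [exact: v2|exact: v1].
- by move=> t tx; apply: ccontB; [exact: h2|exact: h1].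
Qed.

Lemma normc_rint_le k x1 x2 y1 y2 (Mx My : R) : x1 <= x2 -> y1 <= y2 ->
  bcont k x1 x2 y1 y2 ->
  (forall x, x1 <= x <= x2 -> normc (k (x +i* y2) - k (x +i* y1)) <= Mx) ->
  (forall y, y1 <= y <= y2 -> normc (k (x2 +i* y) - k (x1 +i* y)) <= My) ->
  normc (rint k x1 x2 y1 y2) <= 2 * Mx * (x2 - x1) + 2 * My * (y2 - y1).
Proof.
move=> x12 y12 [h1 h2 v1 v2] HMx HMy.
rewrite /rint (le_trans (le_normcB _ _)) // normcM normc_i mul1r lerD //.
- by apply: normc_cint => // t tx; apply: ccontB; [exact: h2|exact: h1].
- by apply: normc_cint => // t ty; apply: ccontB; [exact: v2|exact: v1].
Qed.

(** The factor 4 is the 2 of [normc_cint] times the 2 from the difference over opposite sides. *)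
Lemma rint_bound k x1 x2 y1 y2 (M : R) : x1 <= x2 -> y1 <= y2 ->
  bcont k x1 x2 y1 y2 -> on_bdry x1 x2 y1 y2 (fun z => normc (k z) <= M) ->
  normc (rint k x1 x2 y1 y2) <= 4 * M * ((x2 - x1) + (y2 - y1)).
Proof.
move=> x12 y12 bk [hx hy].
have -> : 4 * M * ((x2 - x1) + (y2 - y1)) =
  2 * (2 * M) * (x2 - x1) + 2 * (2 * M) * (y2 - y1) by ring.
apply: normc_rint_le => // t.
  by move=> /hx[H1 H2]; rewrite (le_trans (le_normcB _ _)) // mulr_natl mulr2n lerD.
by move=> /hy[H1 H2]; rewrite (le_trans (le_normcB _ _)) // mulr_natl mulr2n lerD.
Qed.

Definition rect x1 x2 y1 y2 z := (x1 <= Re z <= x2) && (y1 <= Im z <= y2).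

Lemma cdiff_bcont k x1 x2 y1 y2 : x1 <= x2 -> y1 <= y2 ->
  on_bdry x1 x2 y1 y2 (cdiff k) -> bcont k x1 x2 y1 y2.
Proof.
move=> x12 y12 [hx hy]; split=> t.
- by move=> /hx[/cdiff_hcont].
- by move=> /hx[_ /cdiff_hcont].
- by move=> /hy[/cdiff_vcont].
- by move=> /hy[_ /cdiff_vcont].
Qed.

Lemma on_bdry_rect (P : R[i] -> Prop) x1 x2 y1 y2 : x1 <= x2 -> y1 <= y2 ->
  (forall z, rect x1 x2 y1 y2 z -> P z) -> on_bdry x1 x2 y1 y2 P.
Proof.
by move=> x12 y12 H; split=> t /andP[t1 t2]; split; apply: H; rewrite /rect /= !lexx ?x12 ?y12 t1 t2.
Qed.

(** The differences over opposite sides are the constants [d * 'i * (y2 - y1)] and [d * (x2 - x1)],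
    and the two resulting terms cancel. *)
Lemma rint_affine (c d : R[i]) x1 x2 y1 y2 : x1 <= x2 -> y1 <= y2 ->
  rint (fun z => c + d * z) x1 x2 y1 y2 = 0.
Proof.
move=> x12 y12; rewrite /rint.
rewrite (@eq_cint _ x1 x2 _ (fun=> d * ('i * (y2 - y1)%:C))); last first.
  by move=> t _; apply/eqP; rewrite eq_complex; case: c d => c1 c2 [d1 d2];
    apply/andP; split => /=; apply/eqP; simpc; ring.
rewrite (@eq_cint _ y1 y2 _ (fun=> d * (x2 - x1)%:C)); last first.
  by move=> t _; apply/eqP; rewrite eq_complex; case: c d => c1 c2 [d1 d2];
    apply/andP; split => /=; apply/eqP; simpc; ring.
by rewrite !cint_cst //; ring.
Qed.

(** Subtracting the affine part does not change the integral. What remains is at most [e] times the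
    half perimeter on a boundary of that size, hence the square, which matches the quartering of
    cells in Goursat's argument. *)
Lemma rint_local k p (d : R[i]) (e : R) x1 x2 y1 y2 : x1 <= x2 -> y1 <= y2 -> 0 <= e ->
  rect x1 x2 y1 y2 p -> bcont k x1 x2 y1 y2 ->
  (forall z, rect x1 x2 y1 y2 z ->
    normc (k z - (k p - d * p + d * z)) <= e * normc (z - p)) ->
  normc (rint k x1 x2 y1 y2) <= 4 * e * ((x2 - x1) + (y2 - y1)) ^+ 2.
Proof.
move=> x12 y12 e0 /andP[/andP[p1 p2] /andP[p3 p4]] bk kp.
have ba : bcont (fun z => k p - d * p + d * z) x1 x2 y1 y2.
  apply: cdiff_bcont => //; apply: on_bdry_rect => // z _; exists d => r r0.
  exists 1 => // h _; have -> : k p - d * p + d * (z + h) - (k p - d * p + d * z) - d * h = 0.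
    by ring.
  by rewrite normc0 mulr_ge0 ?normc_ge0 // ltW.
have := rintB bk ba; rewrite rint_affine // subr0 => <-.
rewrite expr2 mulrA -[4 * e * _]mulrA; apply: rint_bound => //.
  case: bk ba => [h1 h2 v1 v2] [h1' h2' v1' v2'].
  split=> t tt; apply: ccontB;
    by [exact: h1|exact: h1'|exact: h2|exact: h2'|exact: v1|exact: v1'|exact: v2|exact: v2'].
apply: on_bdry_rect => // z zr; rewrite (le_trans (kp _ zr)) // ler_wpM2l //.
move/andP: zr => [/andP[z1 z2] /andP[z3 z4]].
rewrite (le_trans (normc_le_ReIm _)) //.
have -> : Re (z - p) = Re z - Re p by case: (z) (p) => ? ? [].
have -> : Im (z - p) = Im z - Im p by case: (z) (p) => ? ? [].
by rewrite lerD // ler_norml; apply/andP; split; lra.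
Qed.

End RectangleIntegral.

Arguments Normc.normc : simpl never.
Arguments rint : simpl never.
Arguments cint : simpl never.

(** * Goursat's theorem for rectangles *)

Section Goursat.
Variable R : realType.
Implicit Types (k l : R[i] -> R[i]) (x y : R) (z p : R[i]).

Lemma goursat k x1 x2 y1 y2 : x1 <= x2 -> y1 <= y2 ->
  (forall z, rect x1 x2 y1 y2 z -> cdiff k z) -> rint k x1 x2 y1 y2 = 0.
Proof.
move=> x12 y12 kd.
have bk a b c d : x1 <= a -> a <= b -> b <= x2 -> y1 <= c -> c <= d -> d <= y2 ->
    bcont k a b c d.
  move=> h1 h2 h3 h4 h5 h6; apply: cdiff_bcont => //; apply: on_bdry_rect => // z.
  move=> /andP[/andP[z1 z2] /andP[z3 z4]]; apply: kd.
  by rewrite /rect (le_trans h1 z1) (le_trans z2 h3) (le_trans h4 z3) (le_trans z4 h6).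
apply: eq0_normc; apply: le_anti; rewrite normc_ge0 andbT.
apply/ler_addgt0Pr => e e0; rewrite add0r.
set w := x2 - x1; set h := y2 - y1.
have w0 : 0 <= w by rewrite subr_ge0.
have h0 : 0 <= h by rewrite subr_ge0.
have xw : x1 + w = x2 by rewrite addrC subrK.
have yh : y1 + h = y2 by rewrite addrC subrK.
have v0 (v : R) n : 0 <= v -> 0 <= v / 2 ^+ n by move=> ?; rewrite divr_ge0 ?exprn_ge0.
(* The tolerance [e] is shared equally among the [4 ^+ n] cells of level [n], so four good children
   make a good parent. *)
pose G n (s : R * R) := normc (rint k s.1 (s.1 + w / 2 ^+ n) s.2 (s.2 + h / 2 ^+ n))
  <= e / 4 ^+ n.
suff : G 0%N (x1, y1) by rewrite /G /= !expr0 !divr1 xw yh.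
apply: (@bisection R w h x1 y1 G w0 h0) => [n x y xx yy xwx yhy Gch|p q].
  have := Gch false false; have := Gch false true; have := Gch true false.
  have := Gch true true; rewrite /G /= !mul0r !addr0 !mul1r.
  have := v0 w n.+1 w0; have := v0 h n.+1 h0.
  rewrite xw yh in xwx yhy; move: xwx yhy.
  have half (v : R) : v / 2 ^+ n = v / 2 ^+ n.+1 + v / 2 ^+ n.+1.
    by rewrite exprS invfM; field; rewrite expf_neq0 // pnatr_eq0.
  have -> : e / 4 ^+ n = 4 * (e / 4 ^+ n.+1).
    by rewrite exprS invfM; field; rewrite expf_neq0 // pnatr_eq0.
  rewrite (half w) (half h) !addrA.
  move: (w / _) (h / _) (e / _) => u v E xu yv v0' u0' e1 e2 e3 e4.
  have xu' : x <= x + u by rewrite lerDl.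
  have xuu : x + u <= x + u + u by rewrite lerDl.
  have yv' : y <= y + v by rewrite lerDl.
  have yvv : y + v <= y + v + v by rewrite lerDl.
  have xx2 : x + u <= x2 by exact: le_trans xu.
  have yy2 : y + v <= y2 by exact: le_trans yv.
  have x1u : x1 <= x + u by exact: le_trans xu'.
  have y1v : y1 <= y + v by exact: le_trans yv'.
  have yvv2 := le_trans yv' yvv; have xuu2 := le_trans xu' xuu.
  rewrite (@rint_splitx _ k x (x + u)) //; last first.
  - by case: (bk x (x + u) y (y + v + v)).
  - exact: bk.
  rewrite (@rint_splity _ k x (x + u) y (y + v)) //; last first.
  - by case: (bk x (x + u) y (y + v)).
  - exact: bk.
  rewrite (@rint_splity _ k (x + u) _ y (y + v)) //; last first.
  - by case: (bk (x + u) (x + u + u) y (y + v)).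
  - exact: bk.
  apply: le_trans (le_normcD _ _) _.
  have := le_normcD (rint k x (x + u) y (y + v)) (rint k x (x + u) (y + v) (y + v + v)).
  have := le_normcD (rint k (x + u) (x + u + u) y (y + v))
    (rint k (x + u) (x + u + u) (y + v) (y + v + v)).
  by lra.
rewrite xw yh => px qy.
have [d Hd] : cdiff k (p +i* q) by apply: kd; rewrite /rect /= px qy.
(* The tolerance for differentiability is chosen so that the bound of [rint_local] on a cell of
   level [n] is at most [e / 4 ^+ n]; the added 1 covers a rectangle reduced to a point. *)
have s0 : 0 < 4 * (w + h) ^+ 2 + 1.
  by rewrite ltr_wpDl // mulr_ge0 // sqr_ge0.
have [r r0 Hr] := Hd (e / (4 * (w + h) ^+ 2 + 1)) ltac:(by rewrite divr_gt0).
have [n Hn] : exists n, (w + h) / 2 ^+ n < r.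
  exists (Num.bound ((w + h) / r)).
  rewrite ltr_pdivrMr ?exprn_gt0 // mulrC -ltr_pdivrMr //.
  have := archi_boundP (divr_ge0 (addr_ge0 w0 h0) (ltW r0)).
  by move=> /lt_le_trans; apply; rewrite -natrX ler_nat ltnW // ltn_expl.
exists n => x y px' qy' xx yy xwx yhy; rewrite /G /=.
have wn := v0 w n w0; have hn := v0 h n h0.
have /rint_local H : rect x (x + w / 2 ^+ n) y (y + h / 2 ^+ n) (p +i* q).
  by rewrite /rect /= px' qy'.
have e1 : 0 <= e / (4 * (w + h) ^+ 2 + 1) by rewrite divr_ge0 // ltW.
have {H} := H k d _ ltac:(by rewrite lerDl) ltac:(by rewrite lerDl) e1
  ltac:(by apply: bk; rewrite ?lerDl).
have -> : x + w / 2 ^+ n - x = w / 2 ^+ n by ring.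
have -> : y + h / 2 ^+ n - y = h / 2 ^+ n by ring.
move=> H; apply: le_trans (H _) _.
  move=> z /andP[/andP[z1 z2] /andP[z3 z4]].
  have -> : k z - (k (p +i* q) - d * (p +i* q) + d * z) =
      k ((p +i* q) + (z - (p +i* q))) - k (p +i* q) - d * (z - (p +i* q)).
    have -> : (p +i* q) + (z - (p +i* q)) = z by rewrite addrC subrK.
    by ring.
  apply: Hr; apply: le_lt_trans Hn; apply: le_trans (normc_le_ReIm _) _.
  rewrite mulrDl; move: px' qy' => /andP[? ?] /andP[? ?].
  move: z1 z2 z3 z4; case: z => a b /= z1 z2 z3 z4.
  by rewrite lerD // ler_norml; apply/andP; split; lra.
rewrite -mulrDl expr_div_n -exprM [(n * 2)%N]mulnC exprM -[2 ^+ 2]/(2 * 2).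
have -> : 2 * 2 = 4 :> R by ring.
rewrite mulrA ler_wpM2r ?invr_ge0 ?exprn_ge0 //.
rewrite [4 * _]mulrC -!mulrA ler_piMr ?(ltW e0) // [_^-1 * _]mulrC ler_pdivrMr //.
by rewrite mul1r lerDl.
Qed.

End Goursat.

(** * Goursat's theorem with a removable puncture *)

Section Punctured.
Variable R : realType.
Implicit Types (k l : R[i] -> R[i]) (x y : R) (z p : R[i]).

Lemma hole_ineqs (p d a b : R) : 0 < d -> d <= p - a -> d <= b - p ->
  [/\ a <= p - d, p - d <= p + d & p + d <= b] /\
  [/\ a <= p + d, p - d <= b & a <= b] /\
  [/\ p != a, p != b, p != p - d & p != p + d] /\ (p - d < p) /\ (p < p + d).
Proof. by move=> d0 da db; do !split; lra. Qed.

(** A small square around [p] is cut out. The four rectangles around it contribute nothing, and on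
    its boundary [k] is small compared with the inverse of its side. *)
Lemma goursat_punctured k p x1 x2 y1 y2 :
  x1 < Re p < x2 -> y1 < Im p < y2 ->
  (forall z, rect x1 x2 y1 y2 z -> z != p -> cdiff k z) ->
  (forall e : R, 0 < e -> exists2 r : R, 0 < r &
     forall h, normc h < r -> normc (h * k (p + h)) <= e) ->
  rint k x1 x2 y1 y2 = 0.
Proof.
case: p => px py /= /andP[px1 px2] /andP[py1 py2] kd kp.
have bk a b c d : x1 <= a -> a <= b -> b <= x2 -> y1 <= c -> c <= d -> d <= y2 ->
    [&& px != a, px != b, py != c & py != d] -> bcont k a b c d.
  move=> h1 h2 h3 h4 h5 h6 /and4P[n1 n2 n3 n4]; apply: cdiff_bcont => //.
  split=> t /andP[t1 t2]; split; apply: kd;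
    rewrite ?eq_complex /rect /= ?negb_and ?(eq_sym _ px) ?(eq_sym _ py)
      ?n1 ?n2 ?n3 ?n4 ?orbT //; lra.
have rk a b c d : x1 <= a -> a <= b -> b <= x2 -> y1 <= c -> c <= d -> d <= y2 ->
    [|| b < px, px < a, d < py | py < c] -> rint k a b c d = 0.
  move=> h1 h2 h3 h4 h5 h6 out; apply: goursat => // -[u v] /andP[/andP[/= z1 z2] /andP[z3 z4]].
  apply: kd; first by rewrite /rect /=; lra.
  by rewrite eq_complex /=; apply/negP => /andP[/eqP uE /eqP vE]; move: out; lra.
apply: eq0_normc; apply: le_anti; rewrite normc_ge0 andbT.
apply/ler_addgt0Pr => e e0; rewrite add0r.
(* A square of half side [d] has half perimeter [4 * d]; with the factor 4 of [rint_bound] this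
   makes 16. *)
have [r r0 Hr] := kp (e / 16) ltac:(by rewrite divr_gt0).
(* The square must fit strictly inside the rectangle, and its points [p + h] must satisfy
   [normc h < r], where [normc h] is bounded by [d + d]. *)
pose d := Num.min (Num.min (px - x1) (x2 - px)) (Num.min (Num.min (py - y1) (y2 - py)) (r / 3)) / 2.
have : 0 < d.
  by rewrite divr_gt0 // !lt_min !subr_gt0 px1 px2 py1 py2 divr_gt0.
have : d * 2 <= Num.min (Num.min (px - x1) (x2 - px)) (Num.min (Num.min (py - y1) (y2 - py)) (r / 3)).
  by rewrite divfK // pnatr_eq0.
rewrite !le_min; move: d => d /andP[/andP[d1 d2] /andP[/andP[d3 d4] d5]] d0.
have xd1 : d <= px - x1 by lra.
have xd2 : d <= x2 - px by lra.
have yd1 : d <= py - y1 by lra.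
have yd2 : d <= y2 - py by lra.
have [[fx1 fx2 fx3] [[fx4 fx5 fx6] [[nx1 nx2 nx3 nx4] [lx1 lx2]]]] := hole_ineqs d0 xd1 xd2.
have [[fy1 fy2 fy3] [[fy4 fy5 fy6] [[ny1 ny2 ny3 ny4] [ly1 ly2]]]] := hole_ineqs d0 yd1 yd2.
have n4 (a b c e' : bool) : a -> b -> c -> e' -> [&& a, b, c & e'] by move=> -> -> -> ->.
have {}bk a b c e' : x1 <= a -> a <= b -> b <= x2 -> y1 <= c -> c <= e' -> e' <= y2 ->
    px != a -> px != b -> py != c -> py != e' -> bcont k a b c e'.
  by move=> *; apply: bk => //; exact: n4.
rewrite (@rint_splitx _ k x1 (px - d)) //; last first.
- by case: (bk x1 (px - d) y1 y2).
- exact: bk.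
rewrite (@rint_splitx _ k (px - d) (px + d)) //; last first.
- by case: (bk x1 (px + d) y1 y2).
- exact: bk.
rewrite (@rint_splity _ k (px - d) (px + d) y1 (py - d)) //; last first.
- by case: (bk (px - d) (px + d) y1 (py - d)).
- exact: bk.
rewrite (@rint_splity _ k (px - d) (px + d) (py - d) (py + d)) //; last first.
- by case: (bk (px - d) (px + d) y1 (py + d)).
- exact: bk.
rewrite (rk x1 (px - d)) ?lx1 //; rewrite (rk (px + d) x2) ?lx2 ?orbT //.
rewrite (rk _ _ y1 (py - d)) ?ly1 ?orbT //; rewrite (rk _ _ (py + d) y2) ?ly2 ?orbT //.
rewrite !add0r !addr0.
have -> : e = 4 * (e / 16 / d) * ((px + d - (px - d)) + (py + d - (py - d))).
  by field; rewrite gt_eqF.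
apply: rint_bound => //; first exact: bk.
have {}d5 : d + d < r by lra.
clear -Hr d0 d5.
have kb (u v : R) : `|u| <= d -> `|v| <= d -> d <= `|u| \/ d <= `|v| ->
    normc (k ((px + u) +i* (py + v))) <= e / 16 / d.
  move=> ud vd uv; have dh : d <= normc (u +i* v).
    case: uv => /le_trans; apply; first exact: (ler_norm_Re (u +i* v)).
    exact: (ler_norm_Im (u +i* v)).
  have -> : (px + u) +i* (py + v) = (px +i* py) + (u +i* v) by simpc.
  have := Hr (u +i* v); rewrite normcM => /(_ _)/wrap[].
    by apply: le_lt_trans (normc_le_ReIm _) _; apply: le_lt_trans d5; exact: lerD.
  move=> H; rewrite ler_pdivlMr // mulrC; apply: le_trans H.
  by rewrite ler_wpM2r ?normc_ge0.
have pxu t : t = px + (t - px) by rewrite addrC subrK.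
have pyu t : t = py + (t - py) by rewrite addrC subrK.
have nd : `|- d| = d by rewrite normrN gtr0_norm.
have pd : `|d| = d by rewrite gtr0_norm.
have tb (q t : R) : q - d <= t <= q + d -> `|t - q| <= d.
  by clear -d0; rewrite ler_norml; lra.
have dd : d <= d by [].
split=> t /tb tt; split.
- by rewrite (pxu t); apply: kb; rewrite ?nd //; right.
- by rewrite (pxu t); apply: kb; rewrite ?pd //; right.
- by rewrite (pyu t); apply: kb; rewrite ?nd //; left.
- by rewrite (pyu t); apply: kb; rewrite ?pd //; left.
Qed.

End Punctured.

(** * Cauchy's estimate at a double zero *)

Section CauchyEstimate.
Variable R : realType.
Implicit Types (f g : R[i] -> R[i]) (z p a : R[i]).

Let mu := @lebesgue_measure R.

Lemma Im_cint_le s t (f : R -> R[i]) M : s <= t -> ccont_on s t f ->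
  (forall x, s <= x <= t -> Im (f x) <= M) -> Im (cint s t f) <= M * (t - s).
Proof.
move=> st cf fM; rewrite /cint /= -Rintegral_segment_cst //.
apply: le_Rintegral => //; first exact: integrable_Im.
apply: continuous_compact_integrable; first exact: segment_compact.
by apply: continuous_subspaceT => x; exact: cvg_cst.
Qed.

Lemma Re_cint_ge s t (f : R -> R[i]) M : s <= t -> ccont_on s t f ->
  (forall x, s <= x <= t -> M <= Re (f x)) -> M * (t - s) <= Re (cint s t f).
Proof.
move=> st cf fM; rewrite /cint /= -Rintegral_segment_cst //.
apply: le_Rintegral => //; last exact: integrable_Re.
apply: continuous_compact_integrable; first exact: segment_compact.
by apply: continuous_subspaceT => x; exact: cvg_cst.
Qed.

(** The exact modulus is 2 pi. A pointwise bound suffices here: [s / (q ^+ 2 + s ^+ 2)] is at least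
    [(2 * s)^-1] on each side, so each pair of opposite sides contributes at most -2 to the
    imaginary part. *)
Lemma rint_cauchy_kernel_ge a (s : R) : 0 < s ->
  4 <= normc (rint (fun z => (z - a)^-1) (Re a - s) (Re a + s) (Im a - s) (Im a + s)).
Proof.
case: a => u v /= s0.
have bk : bcont (fun z => (z - (u +i* v))^-1) (u - s) (u + s) (v - s) (v + s).
  apply: cdiff_bcont; [lra|lra|].
  have H z : z != u +i* v -> cdiff (fun z => (z - (u +i* v))^-1) z.
    move=> zp; apply: derivable_cdiff; apply: derivableVc; first by rewrite subr_eq0.
    by apply: derivableBc; [exact: derivable_idc|exact: derivable_cstc].
  by split=> t tt; split; apply: H; rewrite eq_complex /=; apply/negP => /andP[/eqP ? /eqP ?]; lra.
have key (q : R) : `|q| <= s -> (2 * s)^-1 <= s / (q ^+ 2 + s ^+ 2).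
  move=> qs; have q2 : q ^+ 2 <= s ^+ 2.
    by rewrite -(real_normK (num_real q)) lerXn2r // nnegrE ?ltW.
  have s2 : 0 < s ^+ 2 by rewrite exprn_gt0.
  have d0 : 0 < q ^+ 2 + s ^+ 2 by rewrite ltr_wpDl // sqr_ge0.
  rewrite ler_pdivlMr // mulrC ler_pdivrMr ?mulr_gt0 //.
  have -> : s * (2 * s) = s ^+ 2 + s ^+ 2 by ring.
  by rewrite lerD2r.
case: bk => h1 h2 v1 v2.
apply: le_trans (ler_norm_Im _); rewrite -normrN; apply: le_trans (ler_norm _).
have I1 : Im (cint (u - s) (u + s) (fun x => ((x +i* (v + s)) - (u +i* v))^-1 -
     ((x +i* (v - s)) - (u +i* v))^-1)) <= - s^-1 * ((u + s) - (u - s)).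
  apply: Im_cint_le; first lra.
    by move=> t tt; apply: ccontB; [exact: h2|exact: h1].
  move=> x xs; have xu : `|x - u| <= s by rewrite ler_norml; lra.
  have -> : (x +i* (v + s)) - (u +i* v) = (x - u) +i* s by simpc; congr Complex; ring.
  have -> : (x +i* (v - s)) - (u +i* v) = (x - u) +i* (- s) by simpc; congr Complex; ring.
  have := key _ xu; rewrite invfM /= sqrrN mulNr.
  move: (s / _) => w; have : (2 : R)^-1 = 1 / 2 by rewrite mul1r.
  move=> ->; lra.
have I2 : s^-1 * ((v + s) - (v - s)) <= Re (cint (v - s) (v + s) (fun y =>
     (((u + s) +i* y) - (u +i* v))^-1 - (((u - s) +i* y) - (u +i* v))^-1)).
  apply: Re_cint_ge; first lra.
    by move=> t tt; apply: ccontB; [exact: v2|exact: v1].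
  move=> y ys; have yv : `|y - v| <= s by rewrite ler_norml; lra.
  have -> : ((u + s) +i* y) - (u +i* v) = s +i* (y - v) by simpc; congr Complex; ring.
  have -> : ((u - s) +i* y) - (u +i* v) = (- s) +i* (y - v) by simpc; congr Complex; ring.
  have := key _ yv; rewrite invfM /= sqrrN mulNr [s ^+ 2 + _]addrC.
  move: (s / _) => w; have : (2 : R)^-1 = 1 / 2 by rewrite mul1r.
  move=> ->; lra.
rewrite /rint; move: I1 I2; set A := cint _ _ _; set B := cint _ _ _.
have -> : - s^-1 * (u + s - (u - s)) = - 2 by field; rewrite gt_eqF.
have -> : s^-1 * (v + s - (v - s)) = 2 by field; rewrite gt_eqF.
have -> : Im (A - 'i * B) = Im A - Re B by case: A B => a b [c d] /=; ring.
lra.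
Qed.

(** The third hypothesis says that [g] and its derivative vanish at 0. Hence Cauchy's formula
    applies to [g z / z ^+ 2] at [a], and bounding that quotient on a contour away from 0 gives the
    quadratic estimate. *)
Lemma cauchy_second_order g (M : R) a :
  (forall z, normc z < 1 -> derivable g z 1) ->
  (forall z, normc z < 1 -> normc (g z) <= M) ->
  (forall e : R, 0 < e -> exists2 r : R, 0 < r &
     forall h, normc h < r -> normc (g h) <= e * normc h) ->
  normc a <= 8^-1 -> normc (g a) <= 256 * M * normc a ^+ 2.
Proof.
move=> gd gM g0 a8.
have M0 : 0 <= M by apply: le_trans (gM 0 _); rewrite ?normc_ge0 ?normc0.
have g00 : g 0 = 0.
  have [r r0 H] := g0 1 ltr01; apply: eq0_normc; apply: le_anti.
  by rewrite normc_ge0 andbT; have := H 0; rewrite normc0 mulr0; exact.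
have [->|an0] := eqVneq a 0; first by rewrite g00 normc0 expr0n mulr0.
have a80 : (8 : R)^-1 = 1 / 8 by rewrite mul1r.
have ar : `|Re a| <= 1 / 8 by rewrite (le_trans (ler_norm_Re _)) // -a80.
have ai : `|Im a| <= 1 / 8 by rewrite (le_trans (ler_norm_Im _)) // -a80.
have a1 : normc a < 1 by rewrite (le_lt_trans a8) // a80; lra.
(* The square is centred at [a]. As [normc a <= 1 / 8], it lies in the disc, has 0 in its interior,
   and its boundary stays at distance at least [1 / 8] from 0. *)
pose s : R := 1 / 4.
pose x1 := Re a - s; pose x2 := Re a + s; pose y1 := Im a - s; pose y2 := Im a + s.
have x12 : x1 <= x2 by rewrite /x1 /x2 /s; lra.
have y12 : y1 <= y2 by rewrite /y1 /y2 /s; lra.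
move: (ar) (ai); rewrite !ler_norml => ar' ai'.
have rect1 z : rect x1 x2 y1 y2 z -> normc z < 1.
  move=> /andP[zx zy]; apply: le_lt_trans (normc_le_ReIm _) _.
  have : `|Re z| <= 3 / 8 by move: zx; rewrite /x1 /x2 /s ler_norml; lra.
  have : `|Im z| <= 3 / 8 by move: zy; rewrite /y1 /y2 /s ler_norml; lra.
  lra.
have in0 : x1 < Re (0 : R[i]) < x2 /\ y1 < Im (0 : R[i]) < y2.
  by rewrite /x1 /x2 /y1 /y2 /s /=; lra.
have ina : x1 < Re a < x2 /\ y1 < Im a < y2.
  by rewrite /x1 /x2 /y1 /y2 /s; lra.
pose k1 z := (g z - g a) / (z - a).
pose k2 z := g z / z.
pose k3 z := a * g z / z ^+ 2.
have dk1 z : normc z < 1 -> z != a -> cdiff k1 z.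
  move=> z1 za; apply: derivable_cdiff; apply: derivableMc.
    by apply: derivableBc; [exact: gd|exact: derivable_cstc].
  apply: derivableVc; first by rewrite subr_eq0.
  by apply: derivableBc; [exact: derivable_idc|exact: derivable_cstc].
have dk2 z : normc z < 1 -> z != 0 -> cdiff k2 z.
  move=> z1 za; apply: derivable_cdiff; apply: derivableMc; first exact: gd.
  by apply: derivableVc => //; exact: derivable_idc.
have dk3 z : normc z < 1 -> z != 0 -> cdiff k3 z.
  move=> z1 za; apply: derivable_cdiff; apply: derivableMc.
    by apply: derivableMc; [exact: derivable_cstc|exact: gd].
  apply: derivableVc; first by rewrite expf_neq0.
  by apply: derivableMc; exact: derivable_idc.
have I1 : rint k1 x1 x2 y1 y2 = 0.
  apply: (goursat_punctured ina.1 ina.2) => [z zr|e e0]; first exact/dk1/rect1.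
  have [r r0 Hr] := cdiff_cvg (derivable_cdiff (gd a a1)) e0.
  exists r => // h hr; rewrite /k1 addrAC subrr add0r.
  have [->|h0] := eqVneq h 0; first by rewrite mul0r normc0 ltW.
  by rewrite mulrC divfK //; exact: Hr.
have I2 : rint k2 x1 x2 y1 y2 = 0.
  apply: (goursat_punctured in0.1 in0.2) => [z zr|e e0]; first exact/dk2/rect1.
  have [|r r0 Hr] := cdiff_cvg (derivable_cdiff (gd 0 _)) e0; first by rewrite normc0.
  exists r => // h hr; rewrite /k2 add0r.
  have [->|h0] := eqVneq h 0; first by rewrite mul0r normc0 ltW.
  by rewrite mulrC divfK //; have := Hr _ hr; rewrite add0r g00 subr0.
(* Only here is the vanishing derivative essential: it makes [h * k3 h = a * (g h / h)] tend to
   0. *)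
have I3 : rint k3 x1 x2 y1 y2 = 0.
  apply: (goursat_punctured in0.1 in0.2) => [z zr|e e0]; first exact/dk3/rect1.
  have na : 0 < normc a by rewrite normc_gt0.
  have [r r0 Hr] := g0 (e / normc a) (divr_gt0 e0 na).
  exists r => // h hr; rewrite /k3 add0r.
  have [->|h0] := eqVneq h 0; first by rewrite mul0r normc0 ltW.
  have -> : h * (a * g h / h ^+ 2) = a * (g h / h) by field.
  rewrite !normcM normcV mulrC -ler_pdivlMr // ler_pdivrMr ?normc_gt0 //.
  exact: Hr.
pose l z := (z - a)^-1.
pose K z := a ^+ 2 * g z / (z ^+ 2 * (z - a)).
have bdry (P : R[i] -> Prop) : (forall z, normc z < 1 -> 1/4 <= normc (z - a) ->
    1/8 <= normc z -> P z) -> on_bdry x1 x2 y1 y2 P.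
  move=> HP; have H z : rect x1 x2 y1 y2 z ->
      1 / 4 <= `|Re z - Re a| \/ 1 / 4 <= `|Im z - Im a| -> P z.
    move=> zr zs; have za : 1 / 4 <= normc (z - a).
      case: zs => /le_trans; apply.
        by have := ler_norm_Re (z - a); case: (z) (a) => ? ? [].
      by have := ler_norm_Im (z - a); case: (z) (a) => ? ? [].
    apply: HP => //; first exact: rect1.
    have := le_normcB z a; lra.
  have s4 : `|s| = 1 / 4 by rewrite ger0_norm // /s; lra.
  split=> t tt; split; apply: H; rewrite /rect /= ?tt ?lexx ?x12 ?y12 //;
    rewrite /y1 /y2 /x1 /x2.
  - by right; rewrite addrAC subrr add0r normrN s4.
  - by right; rewrite addrAC subrr add0r s4.
  - by left; rewrite addrAC subrr add0r normrN s4.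
  - by left; rewrite addrAC subrr add0r s4.
have ne z : 1/4 <= normc (z - a) -> z != a.
  by move=> H; rewrite -subr_eq0 -normc_gt0; lra.
have ne0 z : 1/8 <= normc z -> z != 0 by move=> H; rewrite -normc_gt0; lra.
have b1 : bcont k1 x1 x2 y1 y2.
  by apply: cdiff_bcont => //; apply: bdry => z z1 /ne za _; exact: dk1.
have b2 : bcont k2 x1 x2 y1 y2.
  by apply: cdiff_bcont => //; apply: bdry => z z1 _ /ne0 z0; exact: dk2.
have b3 : bcont k3 x1 x2 y1 y2.
  by apply: cdiff_bcont => //; apply: bdry => z z1 _ /ne0 z0; exact: dk3.
have dl z : z != a -> derivable l z 1.
  move=> za; apply: derivableVc; first by rewrite subr_eq0.
  by apply: derivableBc; [exact: derivable_idc|exact: derivable_cstc].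
have bl : bcont l x1 x2 y1 y2.
  by apply: cdiff_bcont => //; apply: bdry => z z1 /ne za _; exact/derivable_cdiff/dl.
have dK z : normc z < 1 -> z != a -> z != 0 -> derivable K z 1.
  move=> z1 za z0; apply: derivableMc.
    by apply: derivableMc; [exact: derivable_cstc|exact: gd].
  apply: derivableVc; first by rewrite mulf_neq0 ?expf_neq0 ?subr_eq0.
  apply: derivableMc; last first.
    by apply: derivableBc; [exact: derivable_idc|exact: derivable_cstc].
  by apply: derivableMc; exact: derivable_idc.
have bK : bcont K x1 x2 y1 y2.
  by apply: cdiff_bcont => //; apply: bdry => z z1 /ne za /ne0 z0; exact/derivable_cdiff/dK.
have bgl : bcont (fun z => g a * l z) x1 x2 y1 y2.
  apply: cdiff_bcont => //; apply: bdry => z z1 /ne za _; apply: derivable_cdiff.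
  by apply: derivableMc; [exact: derivable_cstc|exact: dl].
have b12 : bcont (fun z => k1 z - k2 z) x1 x2 y1 y2.
  apply: cdiff_bcont => //; apply: bdry => z z1 /ne za /ne0 z0; apply: derivable_cdiff.
  apply: derivableBc; apply: derivableMc.
  - by apply: derivableBc; [exact: gd|exact: derivable_cstc].
  - exact: dl.
  - exact: gd.
  - by apply: derivableVc => //; exact: derivable_idc.
(* Partial fractions: [a^2 / (z^2 (z - a)) = 1 / (z - a) - 1 / z - a / z^2]; each of
   [k1], [k2], [k3] has a single puncture, at which it is integrable. *)
have main : g a * rint l x1 x2 y1 y2 = rint K x1 x2 y1 y2.
  rewrite -(rintZ _ bl); apply/eqP; rewrite eq_sym -subr_eq0 -(rintB bK bgl).
  rewrite (@eq_rint _ _ (fun z => (k1 z - k2 z) - k3 z)).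
    by rewrite (rintB b12 b3) (rintB b1 b2) I1 I2 I3 !subr0.
  apply: bdry => z z1 /ne za /ne0 z0; rewrite /K /l /k1 /k2 /k3.
  by field; rewrite z0 subr_eq0 za.
have lower : 4 <= normc (rint l x1 x2 y1 y2).
  by apply: rint_cauchy_kernel_ge; rewrite /s; lra.
have upper : normc (rint K x1 x2 y1 y2) <=
    4 * (256 * M * normc a ^+ 2) * ((x2 - x1) + (y2 - y1)).
  apply: rint_bound => //; apply: bdry => z z1 za z0.
  rewrite /K normcM normcV (normcM (a ^+ 2)) (normcM (z ^+ 2)) !normcX.
  have p1 : 0 < normc z by lra.
  have p2 : 0 < normc (z - a) by lra.
  rewrite ler_pdivrMr ?mulr_gt0 ?exprn_gt0 // [leLHS]mulrC.
  have -> : 256 * M * normc a ^+ 2 * (normc z ^+ 2 * normc (z - a)) =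
    (M * normc a ^+ 2) * (256 * (normc z ^+ 2 * normc (z - a))) by ring.
  (* On the boundary [normc z] is at least [1 / 8] and [normc (z - a)] at least [1 / 4], and 8 * 8 *
     4 = 256. *)
  have H1 : 1 <= 256 * (normc z ^+ 2 * normc (z - a)).
    have : (1 / 8) ^+ 2 * (1 / 4) <= normc z ^+ 2 * normc (z - a).
      by rewrite ler_pM ?exprn_ge0 // ?lerXn2r ?nnegrE ?normc_ge0 //; lra.
    lra.
  have Mn : 0 <= M * normc a ^+ 2 by rewrite mulr_ge0 ?exprn_ge0 ?normc_ge0.
  apply: le_trans (_ : M * normc a ^+ 2 <= _).
    by rewrite ler_wpM2r ?exprn_ge0 ?normc_ge0 // gM.
  by rewrite ler_peMr.
have xx : (x2 - x1) + (y2 - y1) = 1 by rewrite /x1 /x2 /y1 /y2 /s; field.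
rewrite xx mulr1 -main normcM in upper.
have := ler_wpM2l (normc_ge0 (g a)) lower; lra.
Qed.

End CauchyEstimate.

(** * Cyclic vectors and eigenspaces *)

Section Nonderogatory.
Variable C : numClosedFieldType.

Lemma horner_rVpoly_pow n (w : 'rV[C]_n) (t : C) :
  (w *m (\col_i t ^+ i)) 0 0 = (rVpoly w).[t].
Proof.
rewrite mxE /rVpoly horner_poly; apply: eq_bigr => i _.
by rewrite mxE valK.
Qed.

Definition krylov n (A : 'M[C]_n) (v : 'cV[C]_n) : 'M[C]_n :=
  \matrix_(i, k) (A ^+ k *m v) i 0.

Lemma krylov_span n (A : 'M[C]_n) (v : 'cV[C]_n) : krylov A v \in unitmx ->
  (<<mkseq (fun k => A ^+ k *m v) n>> = fullv)%VS.
Proof.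
move=> Ku; apply/eqP; rewrite eqEsubv subvf; apply/subvP => u _.
have -> : u = \sum_k (invmx (krylov A v) *m u) k 0 *: (A ^+ k *m v).
  apply/colP => i; rewrite -{1}(mulKVmx Ku u) mxE summxE.
  by apply: eq_bigr => k _; rewrite !mxE mulrC.
apply: memv_suml => k _; apply: memvZ; apply: memv_span.
by apply/mapP; exists (val k); rewrite // mem_iota ltn_ord.
Qed.

(** A row [w] of the kernel annihilates [A ^+ k *m v] for [k < n]. By Cayley-Hamilton it also
    annihilates [A ^+ n *m v], so [w *m A] passes the same [n] tests. *)
Lemma krylov_kermx_stable n (A : 'M[C]_n) (v : 'cV[C]_n) :
  stablemx (kermx (krylov A v)) A.
Proof.
case: n => [|n] in A v *; first by rewrite thinmx0 sub0mx.
apply/sub_kermxP; set W := kermx _.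
have WA k : (k <= n)%N -> W *m (A ^+ k *m v) = 0.
  move=> kn; have := mulmx_ker (krylov A v); rewrite -/W => /matrixP WK.
  apply/matrixP => i j; rewrite ord1; have := WK i (Ordinal (kn : (k < n.+1)%N)).
  by rewrite !mxE => H; rewrite -[RHS]H; apply: eq_bigr => l _; rewrite !mxE.
have WAn : W *m (A ^+ n.+1 *m v) = 0.
  have /eqP := Cayley_Hamilton A.
  rewrite -[char_poly A]coefK poly_def linear_sum /= size_char_poly big_ord_recr /=.
  have /monicP := char_poly_monic A; rewrite lead_coefE size_char_poly /= => ->.
  rewrite scale1r rmorphXn /= horner_mx_X addrC addr_eq0 => /eqP ->.
  rewrite mulNmx mulmxN mulmx_suml mulmx_sumr big1 ?oppr0 // => k _.
  rewrite linearZ /= rmorphXn /= horner_mx_X -scalemxAl -scalemxAr.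
  by rewrite WA ?scaler0 // -ltnS.
apply/matrixP => i k; rewrite mxE.
have -> : \sum_j (W *m A) i j * krylov A v j k = (W *m (A ^+ k.+1 *m v)) i 0.
  have -> : A ^+ k.+1 *m v = A *m (A ^+ k *m v) by rewrite exprS -mulmxE mulmxA.
  by rewrite (mulmxA W) [RHS]mxE; apply: eq_bigr => j _; rewrite [krylov _ _ _ _]mxE.
have [kn|] := leqP k.+1 n; first by rewrite WA ?mxE.
move=> nk; have -> : k.+1 = n.+1 by apply/eqP; rewrite eqn_leq ltn_ord nk.
by rewrite WAn !mxE.
Qed.

(** The Hautus test: a nonzero left kernel of the Krylov matrix is stable under [A], so it contains
    a left eigenvector [u]; the first column of that matrix being [v], this gives [u *m v = 0]. *)
Lemma hautus n (A : 'M[C]_n) (v : 'cV[C]_n) :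
  (forall a (u : 'rV[C]_n), u *m A = a *: u -> u != 0 -> u *m v != 0) ->
  krylov A v \in unitmx.
Proof.
move=> H; rewrite -row_free_unit -kermx_eq0; apply: contrapT => /negP W0.
set W := kermx _ in W0; have Wst : stablemx W A := krylov_kermx_stable A v.
have [|a] := eigenvalue_closed (restrictmx W A); first by rewrite lt0n mxrank_eq0.
rewrite /eigenvalue; set E := eigenspace _ _ => E0.
have := nz_row_sub E; rewrite sub_eigenspace_conjmx ?stablemx_row_base ?row_base_free //.
set u := nz_row E *m row_base W => /eigenspaceP uA.
have u0 : u != 0 by rewrite mulmx_free_eq0 ?row_base_free // nz_row_eq0.
have uW : (u <= W)%MS by rewrite mulmx_sub // eq_row_base.
have /negP := H a u uA u0; apply.
have n0 : (0 < n)%N by apply: leq_trans (rank_leq_col u); rewrite lt0n mxrank_eq0.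
have uv : (u *m krylov A v) 0 (Ordinal n0) = (u *m v) 0 0.
  by rewrite mxE [RHS]mxE; apply: eq_bigr => k _; rewrite [krylov _ _ _ _]mxE expr0 mul1mx.
by apply/eqP/matrixP => i j; rewrite !ord1 -uv (sub_kermxP uW) !mxE.
Qed.

(* If all eigenspaces are lines, [(1, t, t^2, ...)] is cyclic for generic [t]: its
   product with a left eigenvector [u] is the value at [t] of the polynomial with
   coefficients [u]. *)
Lemma derogatory_rank n (A : 'M[C]_n) :
  ~ (exists v, krylov A v \in unitmx) ->
  exists l : C, (\rank (A - l%:M)%R + 2 <= n)%N.
Proof.
move=> ncyc; apply: contrapT => /forallNP rk; apply: ncyc.
have {}rk l : (\rank (eigenspace A l) <= 1)%N.
  rewrite mxrank_ker leq_subLR; have /negP := rk l.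
  by rewrite -ltnNge addn2 ltnS addn1.
have [rs Ars] := closed_field_poly_normal (char_poly A).
have {}Ars : char_poly A = \prod_(z <- rs) ('X - z%:P).
  by rewrite Ars (monicP (char_poly_monic A)) scale1r.
pose q := \prod_(l <- rs | eigenvalue A l) rVpoly (nz_row (eigenspace A l)).
have q0 : q != 0.
  rewrite prodf_seq_neq0; apply/allP => l _; apply/implyP => el.
  apply: contraNneq (el : eigenspace A l != 0) => H.
  by rewrite -nz_row_eq0 -[nz_row _]rVpolyK H linear0.
have [t qt] := closed_nonrootP _ q0; exists (\col_i t ^+ i).
apply: hautus => a u uA u0.
have ea : eigenvalue A a by apply/eigenvalueP; exists u.
have ars : a \in rs.
  by move: ea; rewrite eigenvalue_root_char Ars root_prod_XsubC.
set w := nz_row (eigenspace A a).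
have w0 : w != 0 by rewrite nz_row_eq0.
have wE : (w <= eigenspace A a)%MS := nz_row_sub _.
have uw : (u <= w)%MS.
  have uE : (u <= eigenspace A a)%MS by apply/eigenspaceP.
  apply: submx_trans uE _.
  by rewrite -(mxrank_leqif_sup wE).2 eqn_leq mxrankS //= rank_rV w0 rk.
have /sub_rVP[c uc] := uw.
have c0 : c != 0 by apply: contraNneq u0 => c0; rewrite uc c0 scale0r.
apply: contraNneq qt => uv.
have : (u *m \col_i t ^+ i) 0 0 = 0 by rewrite uv mxE.
rewrite uc -scalemxAl [X in X = _]mxE horner_rVpoly_pow => /eqP.
rewrite mulf_eq0 (negPf c0) /= => wt.
rewrite /root horner_prod prodf_seq_eq0; apply/hasP; exists a => //.
by rewrite ea.
Qed.

End Nonderogatory.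

(** * Holomorphic operations on scalars and matrices *)

Section DerivableOperations.
Variable R : realType.
Implicit Types (f g : R[i] -> R[i]) (z : R[i]).

Lemma derivable_sumc (I : Type) (s : seq I) (F : I -> R[i] -> R[i]) z :
  (forall i, derivable (F i) z 1) -> derivable (fun x => \sum_(i <- s) F i x) z 1.
Proof.
move=> dF; elim: s => [|i s IH].
  by under eq_fun do rewrite big_nil; exact: derivable_cstc.
by under eq_fun do rewrite big_cons; apply: derivableDc; [exact: (dF i)|exact: IH].
Qed.

Lemma derivable_prodc (I : Type) (s : seq I) (F : I -> R[i] -> R[i]) z :
  (forall i, derivable (F i) z 1) -> derivable (fun x => \prod_(i <- s) F i x) z 1.
Proof.
move=> dF; elim: s => [|i s IH].
  by under eq_fun do rewrite big_nil; exact: derivable_cstc.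
by under eq_fun do rewrite big_cons; apply: derivableMc; [exact: (dF i)|exact: IH].
Qed.

Definition mx_holo m n (F : R[i] -> 'M[R[i]]_(m, n)) z :=
  forall i j, derivable (fun x => F x i j) z 1.

Lemma derivable_det n (F : R[i] -> 'M[R[i]]_n) z :
  mx_holo F z -> derivable (fun x => \det (F x)) z 1.
Proof.
move=> dF; apply: derivable_sumc => s.
apply: derivableMc; first exact: derivable_cstc.
by apply: derivable_prodc => i; exact: dF.
Qed.

Lemma mx_holo_mul m n p (F : R[i] -> 'M[R[i]]_(m, n)) (G : R[i] -> 'M[R[i]]_(n, p)) z :
  mx_holo F z -> mx_holo G z -> mx_holo (fun x => F x *m G x) z.
Proof.
move=> dF dG i j; under eq_fun do rewrite mxE.
by apply: derivable_sumc => k; apply: derivableMc; [exact: dF|exact: dG].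
Qed.

Lemma mx_holo_cst m n (A : 'M[R[i]]_(m, n)) z : mx_holo (fun=> A) z.
Proof. by move=> i j; exact: derivable_cstc. Qed.

Lemma mx_holoD m n (F G : R[i] -> 'M[R[i]]_(m, n)) z :
  mx_holo F z -> mx_holo G z -> mx_holo (fun x => F x + G x) z.
Proof. by move=> dF dG i j; under eq_fun do rewrite mxE; apply: derivableDc; [exact: dF|exact: dG]. Qed.

Lemma mx_holoN m n (F : R[i] -> 'M[R[i]]_(m, n)) z :
  mx_holo F z -> mx_holo (fun x => - F x) z.
Proof. by move=> dF i j; under eq_fun do rewrite mxE; apply: derivableNc; exact: dF. Qed.

Lemma mx_holoZ m n (f : R[i] -> R[i]) (F : R[i] -> 'M[R[i]]_(m, n)) z :
  derivable f z 1 -> mx_holo F z -> mx_holo (fun x => f x *: F x) z.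
Proof. by move=> df dF i j; under eq_fun do rewrite mxE; apply: derivableMc; [exact: df|exact: dF]. Qed.

(* [invmx] is defined by cases on invertibility, hence the adjugate. *)
Lemma mx_holo_inv n (F : R[i] -> 'M[R[i]]_n) z : \det (F z) != 0 ->
  mx_holo F z -> mx_holo (fun x => (\det (F x))^-1 *: \adj (F x)) z.
Proof.
move=> Fz dF; apply: mx_holoZ.
  by apply: derivableVc; [exact: Fz|exact: derivable_det dF].
move=> i j; under eq_fun do rewrite !mxE.
apply: derivableMc; first exact: derivable_cstc.
apply: derivable_det => k l; under eq_fun do rewrite !mxE; exact: dF.
Qed.

End DerivableOperations.

(** * Eigenvalues and the spectral ball *)

Section SpectralBall.
Variable R : realType.
Local Notation C := R[i].

Lemma char_poly_horner n (A : 'M[C]_n) x : (char_poly A).[x] = \det (x%:M - A).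
Proof.
rewrite /char_poly -horner_evalE -det_map_mx; congr (\det _).
by apply/matrixP => i j; rewrite /char_poly_mx !mxE /= horner_evalE !(hornerE, hornerMn).
Qed.

Lemma char_poly_split n (A : 'M[C]_n) : exists2 rs : seq C,
  char_poly A = \prod_(z <- rs) ('X - z%:P) & size rs = n.
Proof.
have [rs Ars] := closed_field_poly_normal (char_poly A).
have {}Ars : char_poly A = \prod_(z <- rs) ('X - z%:P).
  by rewrite Ars (monicP (char_poly_monic A)) scale1r.
exists rs => //; have := size_char_poly A; rewrite Ars size_prod_XsubC.
by case.
Qed.

(** The maximum over the finitely many roots of [char_poly A] serves both purposes: it makes the
    supremum in [spectral_radius] a genuine one, and it keeps the inequality strict. *)
Lemma eigenvalues_bounded n (A : 'M[C]_n) :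
  exists2 M : R, forall l, eigenvalue A l -> normc l <= M &
    (forall l, eigenvalue A l -> normc l < 1) -> M < 1.
Proof.
have [rs Ars _] := char_poly_split A.
have ev l : eigenvalue A l = (l \in rs).
  by rewrite eigenvalue_root_char Ars root_prod_XsubC.
exists (\big[Num.max/0]_(z <- rs) normc z) => [l|H].
  by rewrite ev => lrs; exact: le_bigmax_seq.
rewrite big_seq; elim/big_ind: _ => // [x y x1 y1|z zrs].
  by rewrite gt_max x1.
by apply: H; rewrite ev.
Qed.

Lemma le_spectral_radius n (A : 'M[C]_n) l :
  eigenvalue A l -> normc l <= spectral_radius A.
Proof.
move=> el; have [M leM _] := eigenvalues_bounded A.
by apply: ub_le_sup; [exists M => _ [z ez <-]; exact: leM|exists l].
Qed.

Lemma spectral_ballP n (A : 'M[C]_n) :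
  spectral_ball R n A <-> forall l, eigenvalue A l -> normc l < 1.
Proof.
split=> [A1 l /le_spectral_radius|H]; first by move=> /le_lt_trans; exact.
have [M leM /(_ H) M1] := eigenvalues_bounded A.
rewrite /spectral_ball /= /spectral_radius; set S := (X in sup X).
(* A matrix of size 0 has no eigenvalue; [sup] then has the default value 0, which is below 1. *)
have [->|/set0P S0] := eqVneq S set0; first by rewrite sup0.
by apply: le_lt_trans M1; apply: ge_sup => // _ [z ez <-]; exact: leM.
Qed.

(** The determinant is the product of the [n] factors [l - z] over the eigenvalues [z], each of
    modulus at most 2. *)
Lemma spectral_ball_det_le n (A : 'M[C]_n) (l : C) :
  spectral_ball R n A -> normc l <= 1 -> normc (\det (l%:M - A)) <= 2 ^+ n.
Proof.
move=> /spectral_ballP hA l1; rewrite -char_poly_horner.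
have [rs Ars srs] := char_poly_split A; rewrite -{2}srs.
rewrite Ars horner_prod normc_prod.
have {hA} : {in rs, forall z, normc z < 1}.
  by move=> z zr; apply: hA; rewrite eigenvalue_root_char Ars root_prod_XsubC.
elim: rs {Ars srs} => [|z rs IH] H; first by rewrite big_nil expr0.
rewrite big_cons exprS ler_pM ?normc_ge0 //; last first.
- by apply: IH => y yr; apply: H; rewrite inE yr orbT.
- rewrite !hornerE (le_trans (le_normcB _ _)) //.
  by rewrite -[2]/(1 + 1) lerD // ltW // H // inE eqxx.
by apply: prodr_ge0 => y _; exact: normc_ge0.
Qed.

Lemma eigenvalue_conj n (Q A : 'M[C]_n) l : Q \in unitmx ->
  eigenvalue (Q *m A *m invmx Q) l -> eigenvalue A l.
Proof.
move=> Qu; case/eigenvalueP => v vl v0; apply/eigenvalueP; exists (v *m Q).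
  by rewrite -(mulmxKV Qu (v *m Q *m A)) -!(mulmxA v) mulmxA vl -scalemxAl.
by rewrite mulmx_free_eq0 ?row_free_unit.
Qed.

Lemma spectral_ball_conj n (Q A : 'M[C]_n) : Q \in unitmx ->
  spectral_ball R n A -> spectral_ball R n (Q *m A *m invmx Q).
Proof.
by move=> Qu /spectral_ballP hA; apply/spectral_ballP => l /(eigenvalue_conj Qu); exact: hA.
Qed.

(** As for Gershgorin discs, the eigenvector equation is read at an entry of largest modulus: it
    places [l] within [n%:R * e] of some [d i]. *)
Lemma near_diag_spectral_ball n (d : 'I_n -> C) (X : 'M[C]_n) (e r : R) :
  (forall i, normc (d i) <= 1 - r) -> n%:R * e < r ->
  (forall i j, normc (X i j - (d i) *+ (i == j)) <= e) ->
  spectral_ball R n X.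
Proof.
move=> dr er Xe; apply/spectral_ballP => l /eigenvalueP[v vl v0].
case: n d X dr er Xe v vl v0 => [|n] d X dr er Xe v vl v0.
  by rewrite thinmx0 eqxx in v0.
pose i := [arg max_(i > ord0) normc (v 0 i)]%O.
have vi j : normc (v 0 j) <= normc (v 0 i).
  by rewrite /i; case: arg_maxP => //= k _; exact.
have vi0 : 0 < normc (v 0 i).
  rewrite normc_gt0; apply: contra v0 => /eqP vi0; apply/eqP/rowP => j.
  by rewrite mxE; apply: eq0_normc; apply: le_anti; rewrite normc_ge0 (le_trans (vi j)) // vi0 normc0.
have key : (l - d i) * v 0 i = \sum_j v 0 j * (X j i - (d j) *+ (j == i)).
  move/rowP/(_ i): vl; rewrite !mxE => vl.
  under eq_bigr do rewrite mulrBr; rewrite sumrB vl (bigD1 i) //= eqxx.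
  rewrite mulr1n big1 => [|j /negPf ->]; last by rewrite mulr0n mulr0.
  by rewrite addr0 mulrBl [v 0 i * _]mulrC.
have H : normc (l - d i) <= n.+1%:R * e.
  rewrite -(ler_pM2r vi0) -normcM key (le_trans (normc_sum _ _ _)) //.
  apply: (@le_trans _ _ (\sum_(j < n.+1) normc (v 0 i) * e)).
    by apply: ler_sum => j _; rewrite normcM ler_pM ?normc_ge0.
  by rewrite sumr_const card_ord -mulr_natl; lra.
rewrite -(subrK (d i) l); apply: le_lt_trans (le_normcD _ _) _.
have := dr i; lra.
Qed.

End SpectralBall.

(** * Second order vanishing of a determinant *)

Section DetSecondOrder.
Variable R : realType.
Local Notation C := R[i].

Lemma uniform_radius (I : finType) (P : I -> R -> Prop) :
  (forall i, exists2 e, 0 < e & P i e) ->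
  (forall i e e', 0 < e' -> e' <= e -> P i e -> P i e') ->
  exists2 e, 0 < e & forall i, P i e.
Proof.
move=> HP Pmono.
have [f Hf] : {f & forall i, 0 < f i /\ P i (f i)}.
  by apply: (@choice _ _ (fun i e => 0 < e /\ P i e)) => i; have [e] := HP i; exists e.
exists (\big[Num.min/1]_i f i).
  by elim/big_ind: _ => // [x y x0 y0|i _]; [rewrite lt_min x0|case: (Hf i)].
move=> i; have [fi0 Pi] := Hf i; apply: Pmono Pi; last exact: bigmin_le.
by elim/big_ind: _ => // [x y x0 y0|j _]; [rewrite lt_min x0|case: (Hf j)].
Qed.

(** Leibniz formula. The bounds are given row by row, so that each small row contributes its own
    factor. *)
Lemma normc_det_le n (Y : 'M[C]_n) (c : 'I_n -> R) :
  (forall i j, normc (Y i j) <= c i) -> normc (\det Y) <= n`!%:R * \prod_i c i.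
Proof.
move=> Yc; rewrite (le_trans (normc_sum _ _ _)) //.
apply: (@le_trans _ _ (\sum_(s : 'S_n) \prod_i c i)).
  apply: ler_sum => s _; rewrite normcM normcX normcN normc1 expr1n mul1r.
  rewrite normc_prod; apply: ler_prod => i _; by rewrite normc_ge0 Yc.
by rewrite sumr_const card_Sn mulr_natl.
Qed.

(** One number [e] is at once the radius and, inverted, the constant of both bounds. All three
    survive when [e] shrinks, so [uniform_radius] can give all entries of a matrix the same [e]. *)
Lemma cdiff_lipschitz (f : C -> C) z : cdiff f z -> exists2 e : R, 0 < e &
  forall h, normc h < e -> normc (f (z + h) - f z) <= e^-1 * normc h /\ normc (f z) <= e^-1.
Proof.
move=> [d fd]; have [r r0 H] := fd 1 ltr01.
pose K := normc d + 1 + normc (f z).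
have K0 : 0 < K by rewrite /K ltr_wpDr ?normc_ge0 // ltr_wpDl ?normc_ge0.
have e0 : 0 < Num.min r K^-1 by rewrite lt_min r0 invr_gt0.
have Ke : K <= (Num.min r K^-1)^-1.
  by rewrite -{1}(invrK K) lef_pV2 ?posrE ?invr_gt0 // ge_min lexx orbT.
exists (Num.min r K^-1) => // h; rewrite lt_min => /andP[hr _]; split.
  rewrite -[f (z + h) - f z](subrK (d * h)) (le_trans (le_normcD _ _)) // normcM.
  have hh := normc_ge0 h; have ff := normc_ge0 (f z).
  have H1 : (normc d + 1) * normc h <= (Num.min r K^-1)^-1 * normc h.
    by rewrite ler_wpM2r // (le_trans _ Ke) // /K lerDl.
  apply: le_trans H1; rewrite mulrDl addrC; apply: lerD => //; exact: H.
by rewrite (le_trans _ Ke) // /K lerDr addr_ge0 ?normc_ge0.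
Qed.

(** Multiplying by the inverse of the left factor of the rank normal form of [G 0] makes the last
    two rows vanish at 0. These rows are then of order [normc z] and the others bounded. *)
Lemma det_second_order n (G : C -> 'M[C]_n) : mx_holo G 0 ->
  (\rank (G 0%R) + 2 <= n)%N -> exists K r : R, [/\ 0 < K, 0 < r &
    forall z, normc z < r -> normc (\det (G z)) <= K * normc z ^+ 2].
Proof.
move=> dG; case: n => [|[|m]] in G dG *; rewrite ?addn2 // => rk.
have [L Lu [U GE]] : exists2 L, L \in unitmx &
    exists U : 'M[C]_(m.+2), G 0 = L *m ((pid_mx (\rank (G 0)) : 'M[C]_(m.+2)) *m U).
  exists (col_ebase (G 0)); first exact: col_ebase_unit.
  by exists (row_ebase (G 0)); rewrite mulmxA mulmx_ebase.
move: (\rank _) rk GE => r rk GE; pose Y z := invmx L *m G z.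
have dY : mx_holo Y 0 by apply: mx_holo_mul; [exact: mx_holo_cst|exact: dG].
have Y0 (i j : 'I_m.+2) : (m <= i)%N -> Y 0 i j = 0.
  move=> mi; rewrite /Y GE mulKmx // mxE big1 // => k _; rewrite mxE.
  have -> : (i < r)%N = false by lia.
  by rewrite andbF mul0r.
pose P (ij : 'I_m.+2 * 'I_m.+2) (e : R) := forall h, normc h < e ->
  normc (Y h ij.1 ij.2 - Y 0 ij.1 ij.2) <= e^-1 * normc h /\
  normc (Y 0 ij.1 ij.2) <= e^-1.
have [[i j]|ij e e' e'0 ee H h he'|e e0 He] := @uniform_radius _ P.
- have [e e0 H] := cdiff_lipschitz (derivable_cdiff (dY i j)).
  exists e; first exact: e0.
  by move=> h hh; have := H h hh; rewrite add0r.
- have [H1 H2] := H h (lt_le_trans he' ee).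
  have ii : e^-1 <= e'^-1 by rewrite lef_pV2 // posrE (lt_le_trans e'0).
  split; last exact: le_trans H2 ii.
  by apply: le_trans H1 _; rewrite ler_wpM2r ?normc_ge0.
pose c := 2 * e^-1; have c0 : 0 < c by rewrite mulr_gt0 ?invr_gt0.
exists (normc (\det L) * (m.+2)`!%:R * c ^+ m.+2 + 1), (Num.min e 1); split.
- rewrite ltr_wpDl //; apply: mulr_ge0; last by rewrite exprn_ge0 // ltW.
  by apply: mulr_ge0; [exact: normc_ge0|exact: ler0n].
- by rewrite lt_min e0 ltr01.
move=> z; rewrite lt_min => /andP[ze z1].
have -> : \det (G z) = \det L * \det (Y z) by rewrite -det_mulmx mulKVmx.
rewrite normcM.
have : normc (\det (Y z)) <= (m.+2)`!%:R * \prod_(i < m.+2) (c * (if (m <= i)%N then normc z else 1)).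
  apply: normc_det_le => i j; have [H1 H2] := He (i, j) z ze.
  have ei : 0 < e^-1 by rewrite invr_gt0.
  have zz := normc_ge0 z.
  have ez : 0 <= e^-1 * normc z by rewrite mulr_ge0 // ltW.
  case: ifP => mi; rewrite /c; move: H1 H2 => /=.
    by rewrite (Y0 i j mi) subr0 => H1 _; rewrite (le_trans H1) // -mulrA mulr_natl mulr2n lerDl.
  move=> H1 H2; rewrite -[Y z i j](subrK (Y 0 i j)) (le_trans (le_normcD _ _)) //.
  rewrite mulr1 mulr_natl mulr2n lerD // (le_trans H1) // ler_piMr ?(ltW ei) //.
  exact: ltW.
rewrite big_split /= prodr_const card_ord !big_ord_recr /= big1 => [|i _]; last first.
  by rewrite leqNgt ltn_ord.
rewrite leqnn leqnSn mul1r -expr2 mulrA => H.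
rewrite mulrDl mul1r -!mulrA.
apply: le_trans (ler_wpM2l (normc_ge0 _) H) _.
by rewrite -!mulrA lerDl exprn_ge0 ?normc_ge0.
Qed.

Lemma disc_det_bound n (A B : 'M[C]_n) (l : C) (phi : C -> 'M[C]_n) (a : C) :
  normc l <= 1 -> (\rank (A - l%:M)%R + 2 <= n)%N ->
  holo_disk (spectral_ball R n) phi -> phi 0 = A -> phi a = B -> normc a <= 8^-1 ->
  normc (\det (l%:M - B)) <= 256 * 2 ^+ n * normc a ^+ 2.
Proof.
move=> l1 rk [dphi bphi] phi0 <- a8.
have hol z : normc z < 1 -> mx_holo (fun x => l%:M - phi x) z.
  rewrite -unit_diskE => /dphi /derivable_entriesP H.
  apply: mx_holoD; [exact: mx_holo_cst|apply: mx_holoN; exact: H].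
apply: (@cauchy_second_order R (fun z => \det (l%:M - phi z))).
- by move=> z z1; apply: derivable_det; exact: hol.
- by move=> z z1; apply: spectral_ball_det_le => //; apply: bphi; rewrite unit_diskE.
2: exact: a8.
have [||K [r [K0 r0 H]]] := @det_second_order _ (fun x => l%:M - phi x).
- by apply: hol; rewrite normc0.
- by rewrite phi0 -mxrank_opp opprB.
(* The quadratic bound of [det_second_order] becomes the little-o hypothesis of
   [cauchy_second_order]. *)
move=> e e0; exists (Num.min r (e / K)); first by rewrite lt_min r0 divr_gt0.
move=> h; rewrite lt_min => /andP[hr he].
rewrite (le_trans (H h hr)) // expr2 mulrA ler_wpM2r ?normc_ge0 //.
by rewrite mulrC -ler_pdivlMr // ltW.
Qed.

End DetSecondOrder.

(** * Triangular form and bidiagonal matrices with a corner *)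

Section TriangularForm.
Variable R : realType.
Local Notation C := R[i].

Lemma invmx_uniq n (X Y : 'M[C]_n) : X *m Y = 1%:M -> invmx X = Y.
Proof.
move=> XY; have [Xu _] := mulmx1_unit XY.
by rewrite -[Y]mul1mx -(mulVmx Xu) -mulmxA XY mulmx1.
Qed.

(** After a Schur triangularization, conjugation by the diagonal matrix of the powers of a small [c]
    multiplies entry [(i, j)] by [c ^+ (i - j)] below the diagonal. *)
Lemma small_triangular n (A : 'M[C]_n) (e : R) : (0 < n)%N -> 0 < e ->
  exists2 Q : 'M[C]_n, Q \in unitmx & is_trig_mx (Q *m A *m invmx Q) /\
    forall i j : 'I_n, (j < i)%N -> normc ((Q *m A *m invmx Q) i j) <= e.
Proof.
move=> n0 e0; have [P /unitarymx_unit Pu] := Schur A n0.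
rewrite /similar_to conjumx // => /is_trig_mxP PA.
set T := P *m A *m invmx P in PA.
pose M := \sum_i \sum_j normc (T i j).
have TM i j : normc (T i j) <= M.
  have H k : 0 <= \sum_j normc (T k j) by apply: sumr_ge0 => l _; exact: normc_ge0.
  rewrite /M (bigD1 i) //= (bigD1 j) //= -addrA lerDl addr_ge0 //.
    by apply: sumr_ge0 => l _; exact: normc_ge0.
  by apply: sumr_ge0.
have M0 : 0 <= M by apply: sumr_ge0 => k _; apply: sumr_ge0 => l _; exact: normc_ge0.
(* As [s <= 1], every power occurring below the diagonal is at most [s], and [s * M <= e]; the 1 in
   [M + 1] avoids a zero denominator. *)
pose s := Num.min 1 (e / (M + 1)).
have M1 : 0 < M + 1 by rewrite ltr_wpDl.
have s0 : 0 < s by rewrite lt_min ltr01 divr_gt0.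
have s1 : s <= 1 by rewrite ge_min lexx.
have sM : s * M <= e.
  have : s <= e / (M + 1) by rewrite ge_min lexx orbT.
  rewrite ler_pdivlMr // => H; apply: le_trans H.
  by rewrite ler_wpM2l ?(ltW s0) // lerDl.
pose c : C := s%:C; have c0 : c != 0 by rewrite -normc_gt0 normc_real gtr0_norm.
pose S := diag_mx (\row_(i < n) c ^+ i); pose S' := diag_mx (\row_(i < n) c ^- i).
have SS' : S *m S' = 1%:M.
  apply/matrixP => i j; rewrite mul_diag_mx !mxE.
  by case: eqP => [->|_]; rewrite ?mulr0n ?mulr0 // mulr1n divff // expf_neq0.
have [Su _] := mulmx1_unit SS'.
exists (S *m P); first by rewrite unitmx_mul Su.
have -> : S *m P *m A *m invmx (S *m P) = S *m T *m S'.
  rewrite (@invmx_uniq _ _ (invmx P *m S')) /T ?mulmxA //.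
  by rewrite -!mulmxA mulKVmx.
have E i j : (S *m T *m S') i j = c ^+ i * T i j * c ^- j.
  by rewrite mul_mx_diag mxE mul_diag_mx !mxE.
split; first by apply/is_trig_mxP => i j ij; rewrite E PA // mulr0 mul0r.
move=> i j ji; rewrite E.
have -> : c ^+ i * T i j * c ^- j = c ^+ (i - j) * T i j.
  rewrite -{1}(subnK (ltnW ji)) exprD; field; exact: expf_neq0.
rewrite normcM normcX normc_real gtr0_norm //; apply: le_trans sM.
rewrite ler_pM ?exprn_ge0 ?normc_ge0 ?(ltW s0) //.
have : (0 < i - j)%N by rewrite subn_gt0.
case: (i - j)%N => // k _; rewrite exprS ler_piMr ?(ltW s0) // exprn_ile1 ?(ltW s0) //.
Qed.

(** The corner [b] closes the cycle formed by the subdiagonal, so it enters the determinant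
    linearly. With [b = 0] the matrix is lower triangular with spectrum [d]. *)
Definition bidiag n (d : 'I_n -> C) (c b : C) : 'M[C]_n :=
  \matrix_(i, j) (d i *+ (i == j) + c *+ (i == j.+1 :> nat) +
                  b *+ ((i == 0%N :> nat) && (j.+1 == n :> nat))).

(** The first row has only the entries [d ord0] and [b], and both of their minors are triangular. *)
Lemma det_bidiag m (d : 'I_m.+2 -> C) (c b : C) :
  \det (bidiag d c b) = \prod_i d i + (-1) ^+ m.+1 * b * c ^+ m.+1.
Proof.
rewrite (expand_det_row _ ord0) (bigD1 ord0) //= (bigD1 ord_max) //=.
rewrite big1 ?addr0 => [|j /andP[j0 jm]]; last first.
  rewrite mxE /= eq_sym (negPf j0) eqSS.
  have -> : (j == m.+1 :> nat) = false by apply/negbTE; move: jm; rewrite -val_eqE.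
  by rewrite /= !mulr0n !addr0 mul0r.
have -> : bidiag d c b ord0 ord0 = d ord0.
  by rewrite mxE /= ?eqSS /= !mulr0n mulr1n !addr0.
have -> : bidiag d c b ord0 ord_max = b.
  by rewrite mxE /= ?eqxx /= !mulr0n mulr1n !add0r.
rewrite /cofactor /= expr0 mul1r add0n.
have -> : \det (row' ord0 (col' ord0 (bidiag d c b))) = \prod_i d (lift ord0 i).
  rewrite det_trig; last first.
    apply/is_trig_mxP => i j ij; rewrite !mxE /= /bump /= !add1n !eqSS.
    rewrite -val_eqE /= /bump /= !add1n eqSS.
    by rewrite (ltn_eqF ij) (ltn_eqF (leqW ij)) /= !mulr0n !addr0.
  apply: eq_bigr => i _; rewrite !mxE /= /bump /= !add1n eqxx eqSS.
  by rewrite (ltn_eqF (ltnSn _)) /= !mulr0n mulr1n !addr0.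
have -> : \det (row' ord0 (col' ord_max (bidiag d c b))) = c ^+ m.+1.
  rewrite -det_tr det_trig; last first.
    apply/is_trig_mxP => i j ij; rewrite !mxE /= /bump /= !add1n !eqSS.
    rewrite leqNgt ltn_ord add0n -val_eqE /= /bump /= leqNgt ltn_ord add0n add1n.
    rewrite [(j.+1 == i :> nat)]gtn_eqF ?(ltn_trans ij) //.
    by rewrite [(j == i :> nat)]gtn_eqF //= !mulr0n !addr0.
  rewrite -[in RHS](card_ord m.+1) -prodr_const; apply: eq_bigr => i _.
  rewrite !mxE /= /bump /= !add1n !eqSS leqNgt ltn_ord add0n eqxx -val_eqE /=.
  rewrite /bump /= leqNgt ltn_ord add0n add1n [(i.+1 == i :> nat)]gtn_eqF //.
  by rewrite /= !mulr0n mulr1n addr0 add0r.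
by rewrite [in RHS]big_ord_recl; ring.
Qed.

End TriangularForm.

(** * Newton vectors of a triangular matrix *)

Section NewtonBasis.

(** The Newton polynomial [(X - x_(k-1)) ... (X - x_0)] at the diagonal entries of [X], applied to
    the first basis vector. The ring is general so that polynomial entries are allowed. *)
Fixpoint newton (S : pzRingType) m (X : 'M[S]_m.+1) (k : nat) : 'cV[S]_m.+1 :=
  if k is l.+1 then (X - (X (inord l) (inord l))%:M) *m newton X l
  else delta_mx 0 0.

Lemma newton_map (S S' : pzRingType) (f : {rmorphism S -> S'}) m (X : 'M[S]_m.+1) k :
  map_mx f (newton X k) = newton (map_mx f X) k.
Proof.
elim: k => [|k IH] /=; first by rewrite map_delta_mx.
by rewrite map_mxM IH map_mxB map_scalar_mx mxE.
Qed.

(** For lower triangular [X], each factor kills one more leading coordinate, because [X - x_k] has a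
    zero at diagonal position [k]. For [k = m.+1] the whole vector vanishes. *)
Lemma newton_support (S : pzRingType) m (X : 'M[S]_m.+1) k (i : 'I_m.+1) :
  is_trig_mx X -> (i < k)%N -> newton X k i 0 = 0.
Proof.
move=> /is_trig_mxP Xt; elim: k i => // k IH i ik; rewrite /= mxE big1 // => j _.
have [jk|kj] := ltnP j k; first by rewrite IH ?mulr0.
rewrite !mxE; move: ik; rewrite ltnS => ik.
have [ij|ji] := ltnP i j.
  by rewrite Xt // -val_eqE /= (ltn_eqF ij) subr0 mul0r.
have ijk : i = j by apply/val_inj/eqP; rewrite eqn_leq ji (leq_trans ik kj).
have -> : inord k = i.
  by apply: val_inj; rewrite /= inordK; [apply/eqP; rewrite eqn_leq ik ijk kj|exact: leq_ltn_trans kj (ltn_ord j)].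
by rewrite -ijk eqxx mulr1n subrr mul0r.
Qed.

Definition subdiag (S : pzRingType) m : 'M[S]_m := \matrix_(i, j) (i == j.+1 :> nat)%:R.

Lemma newton_subdiag (S : pzRingType) m k : (k < m.+1)%N ->
  newton (subdiag S m.+1) k = delta_mx (inord k) 0.
Proof.
elim: k => [|k IH] km /=.
  by congr delta_mx; apply: val_inj; rewrite /= inordK.
have -> : subdiag S m.+1 (inord k) (inord k) = 0 by rewrite mxE ltn_eqF.
rewrite IH 1?ltnW // raddf0 subr0.
apply/matrixP => i j; rewrite ord1 mxE (bigD1 (inord k)) //= big1 ?addr0 => [|l lk].
  by rewrite !mxE !eqxx mulr1 -val_eqE /= !inordK // 1?ltnW // andbT.
by rewrite !mxE (negPf lk) mulr0.
Qed.

(** Otherwise the [size q] distinct numbers from [N] on would all be roots, one more than the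
    degree. *)
Lemma poly_large_nonroot (F : numFieldType) (q : {poly F}) (N : nat) : q != 0 ->
  exists2 m, (N <= m)%N & q.[m%:R] != 0.
Proof.
move=> q0; apply: contrapT => H.
pose rs := [seq ((N + i)%N%:R : F) | i <- iota 0 (size q)].
have : (size rs < size q)%N.
  apply: max_poly_roots => //.
    apply/allP => _ /mapP[i _ ->]; rewrite /root; apply: contrapT => /negP qi.
    by apply: H; exists (N + i)%N; rewrite ?leq_addr.
  rewrite map_inj_uniq ?iota_uniq // => i j /eqP.
  by rewrite eqr_nat eqn_add2l => /eqP.
by rewrite size_map size_iota ltnn.
Qed.

End NewtonBasis.

(** * Perturbation to a conjugate of a bidiagonal matrix *)

Section CyclicPerturbation.
Variable R : realType.
Local Notation C := R[i].

(* The columns of [T] are multiples of the [newton Y k], on which [Y] is bidiagonal.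
   Their diagonal entries are polynomials in [t] for [Y = subdiag + t *: A], equal
   to [1] at [t = 0], so they do not vanish for large [t]. *)
Lemma cyclic_perturbation m (A : 'M[C]_m.+1) (e : C) (N : nat) : is_trig_mx A -> e != 0 ->
  exists2 k, (N <= k)%N & exists T : 'M[C]_m.+1,
    [/\ is_trig_mx T, forall i, T i i != 0 &
      (A + k.+1%:R^-1 *: subdiag C m.+1) *m T = T *m bidiag (fun i => A i i) e 0].
Proof.
move=> At e0; have /is_trig_mxP At' := At.
pose Y t : 'M[C]_m.+1 := subdiag C m.+1 + t *: A.
(* [P] is [Y] with [t] an indeterminate. *)
pose P : 'M[{poly C}]_m.+1 := map_mx polyC (subdiag C m.+1) + 'X *: map_mx polyC A.
have PY t : map_mx (horner_eval t) P = Y t.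
  apply/matrixP => i j; rewrite !mxE /= horner_evalE !hornerE.
  by [].
have tP k i t : (newton P k i 0).[t] = newton (Y t) k i 0.
  by rewrite -PY -newton_map mxE.
pose q := \prod_(i < m.+1) newton P i i 0.
have q0 : q != 0.
  apply: contraTneq isT => q0; have : q.[0] = 0 by rewrite q0 horner0.
  rewrite horner_prod => /eqP/prodf_eq0[i _]; rewrite tP /Y scale0r addr0.
  rewrite newton_subdiag // inord_val mxE !eqxx oner_eq0 //.
(* Asking for [N.+1] makes the nonroot a successor [k.+1] with [N <= k], so [t] is invertible. *)
have [k Nk qk] := poly_large_nonroot N.+1 q0.
case: k Nk qk => // k Nk; set t : C := k.+1%:R => qk.
have t0 : t != 0 by rewrite pnatr_eq0.
exists k; first by rewrite -ltnS.
have Yt : is_trig_mx (Y t).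
  apply/is_trig_mxP => i j ij; rewrite !mxE At' // mulr0 addr0.
  by rewrite (ltn_eqF (leqW ij)).
have te0 : t * e != 0 by rewrite mulf_neq0.
(* On the Newton vectors [Y t] has subdiagonal entries 1; scaling the vectors by powers of [t * e]
   turns them into [t * e], hence into [e] for [t^-1 *: Y t]. *)
pose T : 'M[C]_m.+1 := \matrix_(i, j) ((t * e) ^- j * newton (Y t) j i 0).
exists T; split.
- by apply/is_trig_mxP => i j ij; rewrite mxE newton_support ?mulr0.
- move=> i; rewrite mxE mulf_neq0 ?invr_eq0 ?expf_neq0 // -tP.
  by apply: contra qk => /eqP qi; rewrite horner_prod (bigD1 i) //= qi mul0r.
have AY : A + t^-1 *: subdiag C m.+1 = t^-1 *: Y t.
  by rewrite /Y scalerDr scalerA mulVf // scale1r addrC.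
rewrite AY; apply/matrixP => i j.
have step : Y t *m newton (Y t) j = newton (Y t) j.+1 + (t * A j j) *: newton (Y t) j.
  rewrite /= mulmxBl mul_scalar_mx inord_val.
  have -> : Y t j j = t * A j j by rewrite !mxE (ltn_eqF (ltnSn _)) add0r.
  by rewrite subrK.
have -> : (t^-1 *: Y t *m T) i j = t^-1 * (t * e) ^- j * (Y t *m newton (Y t) j) i 0.
  rewrite -scalemxAl mxE -mulrA; congr (_ * _); rewrite mxE [in RHS]mxE mulr_sumr.
  by apply: eq_bigr => l _; rewrite [T _ _]mxE mulrCA.
rewrite step mxE [in RHS]mxE.
under eq_bigr => l _ do rewrite [bidiag _ _ _ _ _]mxE mul0rn addr0 mulrDr.
rewrite big_split /= (bigD1 j) //= eqxx mulr1n big1 ?addr0 => [|l lj]; last first.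
  by rewrite (negPf lj) mulr0n mulr0.
have -> : \sum_l T i l * (e *+ (l == j.+1 :> nat)) = t^-1 * (t * e) ^- j * newton (Y t) j.+1 i 0.
  have [jm|jm] := ltnP j.+1 m.+1.
    rewrite (bigD1 (Ordinal jm)) //= eqxx mulr1n big1 ?addr0 => [|l lj]; last first.
      by move: lj; rewrite -val_eqE /= => /negPf ->; rewrite mulr0n mulr0.
    rewrite mxE [(t * e) ^+ j.+1]exprS invfM [(t * e)^-1]invfM.
    move: (newton _ _ _ _) => w; move: ((t * e) ^- j) (t^-1) => u t'.
    by field.
  (* In the last column there is no row [j.+1], and the corresponding Newton vector is zero. *)
  rewrite newton_support ?mulr0 ?(leq_trans (ltn_ord i)) // big1 // => l _.
  by rewrite (ltn_eqF (leq_trans (ltn_ord l) jm)) mulr0n mulr0.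
rewrite [X in _ = X * _ + _]mxE [X in _ * (_ + X) = _]mxE.
move: (newton _ _ _ _) => w; move: (newton _ _ _ _) => w'.
move: ((t * e) ^- j) => u; field.
by [].
Qed.

End CyclicPerturbation.

(** * Iterated square roots near 1 *)

Section NearOneRoot.
Variable R : realType.
Local Notation C := R[i].

Lemma sqrt_right_half (x : C) : exists2 w, w ^+ 2 = x & 0 <= Re w.
Proof.
have [s0|s0] := leP 0 (Re (sqrtC x)); first by exists (sqrtC x); rewrite ?sqrtCK.
exists (- sqrtC x); first by rewrite sqrrN sqrtCK.
by case: (sqrtC x) s0 => a b /=; rewrite oppr_ge0 => /ltW.
Qed.

(** Since [w ^+ 2 - 1 = (w - 1) * (w + 1)], this is the factor by which a square root in the right
    half plane comes closer to 1. *)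
Lemma normc_add1_ge (w : C) (m : R) : 0 <= Re w -> 0 <= m -> m <= 1 -> m <= normc w ->
  1 + m ^+ 2 / 3 <= normc (w + 1).
Proof.
move=> w0 m0 m1 mw.
have n2 z : normc z ^+ 2 = Re z ^+ 2 + Im z ^+ 2.
  by case: z => a b; rewrite /normc sqr_sqrtr // addr_ge0 ?sqr_ge0.
have k0 : 0 <= 1 + m ^+ 2 / 3 by rewrite addr_ge0 // divr_ge0 ?sqr_ge0.
rewrite -(ler_sqr k0 (normc_ge0 _)) n2.
have mw2 : m ^+ 2 <= normc w ^+ 2 by rewrite ler_sqr ?nnegrE ?normc_ge0.
have m21 : m ^+ 2 <= 1 by rewrite expr_le1.
have m20 : 0 <= m ^+ 2 by rewrite sqr_ge0.
have m4 : m ^+ 2 * m ^+ 2 <= m ^+ 2 by rewrite ler_piMr.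
rewrite n2 in mw2; move: w0 mw2; case: w {mw} => a b /= a0 mw2.
rewrite addr0; move: m4 m20 mw2 m21; rewrite !expr2; nra.
Qed.

(** Square roots are taken repeatedly in the right half plane. Their moduli stay above [m], so each
    step divides the distance to 1 by at least [1 + x]; the linear consequence [1 + k%:R * x] is
    enough for the Archimedean property. *)
Lemma near_one_root (d : C) (e : R) : d != 0 -> 0 < e ->
  exists w k, w ^+ (2 ^ k) = d /\ normc (w - 1) <= e.
Proof.
move=> d0 e0; pose m := Num.min 1 (normc d).
have m0 : 0 < m by rewrite lt_min ltr01 normc_gt0.
have m1 : m <= 1 by rewrite ge_min lexx.
pose x := m ^+ 2 / 3; have x0 : 0 < x by rewrite divr_gt0 // exprn_gt0.
have H k : exists w, [/\ w ^+ (2 ^ k) = d, m <= normc w &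
    normc (w - 1) * (1 + k%:R * x) <= normc (d - 1)].
  elim: k => [|k [w [wd mw w1]]].
    by exists d; rewrite expn0 expr1 mul0r addr0 mulr1; split=> //; rewrite ge_min lexx orbT.
  have [v vw v0] := sqrt_right_half w; exists v.
  have mv : m <= normc v.
    rewrite leNgt; apply/negP => vm; move: mw; rewrite -vw normcX leNgt => /negP; apply.
    have v1 := ltW (lt_le_trans vm m1).
    by apply: le_lt_trans vm; rewrite expr2 ler_piMr ?normc_ge0.
  split=> //; first by rewrite expnS exprM vw.
  have vv : normc (v - 1) * (1 + x) <= normc (w - 1).
    have -> : w - 1 = (v - 1) * (v + 1) by rewrite -vw; ring.
    by rewrite normcM ler_wpM2l ?normc_ge0 // normc_add1_ge // ltW.
  apply: le_trans w1; have kx : 0 <= k%:R * x by rewrite mulr_ge0 // ltW.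
  apply: le_trans (_ : normc (v - 1) * (1 + x) * (1 + k%:R * x) <= _).
    rewrite -mulrA ler_wpM2l ?normc_ge0 // -natr1 mulrDl mul1r.
    have : 0 <= x * (k%:R * x) by rewrite mulr_ge0 // ltW.
    lra.
  by rewrite ler_wpM2r // addr_ge0.
pose k := Num.bound (normc (d - 1) / (e * x)).
have [w [wd _ w1]] := H k; exists w, k; split=> //.
have : normc (d - 1) / (e * x) < k%:R.
  by apply: archi_boundP; rewrite divr_ge0 ?normc_ge0 // mulr_ge0 // ltW.
rewrite ltr_pdivrMr ?mulr_gt0 // => kd.
have kx : 0 <= k%:R * x by rewrite mulr_ge0 // ltW.
have k1 : 0 < 1 + k%:R * x by rewrite ltr_pwDl.
rewrite -(ler_pM2r k1); apply: le_trans w1 _; apply: ltW; apply: lt_le_trans kd _.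
by rewrite mulrCA ler_wpM2l ?(ltW e0) // lerDr.
Qed.

End NearOneRoot.

(** * Construction of the analytic discs *)

Section Discs.
Variable R : realType.
Local Notation C := R[i].

Lemma derivableXc (f : C -> C) n z : derivable f z 1 ->
  derivable (fun x => f x ^+ n) z 1.
Proof.
move=> df; elim: n => [|n IH].
  by under eq_fun do rewrite expr0; exact: derivable_cstc.
by under eq_fun do rewrite exprS; apply: derivableMc; [exact: df|exact: IH].
Qed.

(* A diagonal entry [w ^ (2 ^ k)] of [T], with [w] close to [1], is joined to [1] by
   [(1 + c (w - 1)) ^ (2 ^ k)] with [c] affine, which has no zero in the disc. *)
Lemma triangular_path n (T : 'M[C]_n) (t : R) : 0 < t -> is_trig_mx T ->
  (forall i, T i i != 0) -> exists F : C -> 'M[C]_n, [/\ F 0 = T, F t%:C = 1%:M &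
    forall z, normc z < 1 -> mx_holo F z /\ \det (F z) != 0].
Proof.
move=> t0 /is_trig_mxP Tt T0; have ti0 : 0 < t^-1 by rewrite invr_gt0.
(* On the disc the affine [c] below is at most [1 + t^-1] in modulus, so this tolerance keeps
   [c z * (w - 1)] within [1 / 2] of 0. *)
have e0 : 0 < (1 + t^-1)^-1 / 2 by rewrite divr_gt0 // invr_gt0 addr_gt0.
have [wk Hwk] : {wk : 'I_n -> C * nat & forall i,
    (wk i).1 ^+ (2 ^ (wk i).2) = T i i /\ normc ((wk i).1 - 1) <= (1 + t^-1)^-1 / 2}.
  apply: (@choice _ _ (fun i (wk : C * nat) => wk.1 ^+ (2 ^ wk.2) = T i i /\
    normc (wk.1 - 1) <= (1 + t^-1)^-1 / 2)) => i.
  by have [w [k H]] := near_one_root (T0 i) e0; exists (w, k).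
have tc0 : t%:C != 0 :> C by rewrite -normc_gt0 normc_real gtr0_norm.
pose c (z : C) : C := 1 - z * (t%:C)^-1.
have dc z : derivable c z 1.
  apply: derivableBc; first exact: derivable_cstc.
  by apply: derivableMc; [exact: derivable_idc|exact: derivable_cstc].
pose g i (z : C) : C := (1 + c z * ((wk i).1 - 1)) ^+ (2 ^ (wk i).2).
have dg i z : derivable (g i) z 1.
  apply: derivableXc; apply: derivableDc; first exact: derivable_cstc.
  by apply: derivableMc; [exact: dc|exact: derivable_cstc].
have g0 i z : normc z < 1 -> g i z != 0.
  move=> z1; rewrite expf_neq0 // -normc_gt0.
  have c1 : normc (c z) <= 1 + t^-1.
    rewrite (le_trans (le_normcB _ _)) // normc1 lerD2l normcM normcV normc_real.
    by rewrite gtr0_norm // ler_piMl ?(ltW ti0) // ltW.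
  have H : normc (c z * ((wk i).1 - 1)) <= 1 / 2.
    rewrite normcM; have [_ w1] := Hwk i.
    apply: le_trans (ler_pM (normc_ge0 _) (normc_ge0 _) c1 w1) _.
    by rewrite mulrA divff ?mul1r // gt_eqF // addr_gt0.
  have := le_normcB_l 1 (- (c z * ((wk i).1 - 1))).
  rewrite opprK normcN normc1 => H2.
  by apply: lt_le_trans H2; lra.
(* The off-diagonal part is multiplied by [c], which is 1 at 0 and 0 at [t]. The path stays
   triangular, so only its diagonal matters for invertibility. *)
exists (fun z => \matrix_(i, j) if i == j then g i z else c z * T i j); split.
- apply/matrixP => i j; rewrite mxE /g /c mul0r subr0 !mul1r.
  by case: eqP => [->|//]; rewrite addrCA subrr addr0; have [] := Hwk j.
- apply/matrixP => i j; rewrite !mxE /g /c divff // subrr !mul0r addr0 expr1n.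
  by case: eqP.
move=> z z1; split.
  move=> i j; under eq_fun do rewrite mxE.
  case: (i == j); first exact: dg.
  by apply: derivableMc; [exact: dc|exact: derivable_cstc].
rewrite det_trig.
  by rewrite prodf_seq_neq0; apply/allP => i _; rewrite mxE eqxx g0.
apply/is_trig_mxP => i j ij; rewrite mxE Tt // mulr0.
by rewrite -val_eqE /= (ltn_eqF ij).
Qed.

Lemma mx_holo_bidiag n (d : 'I_n -> C) (e : C) (b : C -> C) z : derivable b z 1 ->
  mx_holo (fun x => bidiag d e (b x)) z.
Proof.
move=> db i j; under eq_fun do rewrite mxE.
apply: derivableDc; first exact: derivable_cstc.
case: (_ && _); last by under eq_fun do rewrite mulr0n; exact: derivable_cstc.
by under eq_fun do rewrite mulr1n; exact: db.
Qed.

Lemma cyclic_disc n (A T : 'M[C]_n) (d : 'I_n -> C) (e : C) (t : R) : 0 < t ->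
  is_trig_mx T -> (forall i, T i i != 0) -> A *m T = T *m bidiag d e 0 ->
  (forall z, normc z < 1 -> spectral_ball R n (bidiag d e (e * z))) ->
  exists phi, [/\ holo_disk (spectral_ball R n) phi, phi 0 = A &
    phi t%:C = bidiag d e (e * t%:C)].
Proof.
move=> t0 Tt T0 AT Hball; have [F [F0 Ft HF]] := triangular_path t0 Tt T0.
have invE (M : 'M[C]_n) : \det M != 0 -> (\det M)^-1 *: \adj M = invmx M.
  by move=> M0; rewrite /invmx unitmxE unitfE M0.
exists (fun z => F z *m bidiag d e (e * z) *m ((\det (F z))^-1 *: \adj (F z))); split.
- split=> z; rewrite unit_diskE => z1; have [hF dF] := HF z z1.
    apply/derivable_entriesP; apply: mx_holo_mul; last exact: mx_holo_inv.
    apply: mx_holo_mul; first exact: hF.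
    apply: mx_holo_bidiag.
    by apply: derivableMc; [exact: derivable_cstc|exact: derivable_idc].
  rewrite invE //; apply: spectral_ball_conj; last exact: Hball.
  by rewrite unitmxE unitfE.
- have Tu : T \in unitmx.
    rewrite unitmxE unitfE (det_trig Tt) prodf_seq_neq0.
    by apply/allP => i _; exact: T0.
  rewrite F0 invE; last by rewrite -unitfE -unitmxE.
  by rewrite mulr0 -AT mulmxK.
- by rewrite Ft invE ?det1 ?oner_eq0 // invmx1 mulmx1 mul1mx.
Qed.

(** The hypothesis puts [l] among the diagonal entries, which leaves only the cycle through the
    corner. *)
Lemma det_sub_bidiag m (d : 'I_m.+2 -> C) (e b l : C) : \prod_i (l - d i) = 0 ->
  normc (\det (l%:M - bidiag d e b)) = normc b * normc e ^+ m.+1.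
Proof.
move=> H.
have -> : l%:M - bidiag d e b = bidiag (fun i => l - d i) (- e) (- b).
  apply/matrixP => i j; rewrite !mxE mulrnBl !mulNrn; ring.
rewrite det_bidiag H add0r !normcM !normcX !normcN normc1 expr1n mul1r.
by [].
Qed.

Lemma bidiag_entry_le n (d : 'I_n -> C) (e b : C) (r : R) i j :
  normc e <= r -> normc b <= r ->
  normc (bidiag d e b i j - (d i) *+ (i == j)) <= 2 * r.
Proof.
move=> er br; rewrite mxE; set x := d i *+ _.
have -> y w : x + y + w - x = y + w :> C by ring.
have r0 : 0 <= r by apply: le_trans er; exact: normc_ge0.
have H (y : C) (c : bool) : normc y <= r -> normc (y *+ c) <= r.
  by case: c => // _; rewrite mulr0n normc0.
by rewrite (le_trans (le_normcD _ _)) // mulr_natl mulr2n lerD // H.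
Qed.

(** Provides a disc from [A] that reaches [B] at [1 / 2]. Its deviation from the diagonal is at most
    [e] from [A] plus [2 * (3 * e)] from the increment, hence the 7. *)
Lemma segment_disc n (A B : 'M[C]_n) (d : 'I_n -> C) (e r : R) :
  (forall i, normc (d i) <= 1 - r) -> n%:R * (7 * e) < r ->
  (forall i j, normc (A i j - (d i) *+ (i == j)) <= e) ->
  (forall i j, normc (B i j - (d i) *+ (i == j)) <= 2 * e) ->
  holo_disk (spectral_ball R n) (fun z => A + (2 * z) *: (B - A)).
Proof.
move=> dr er Ae Be; split=> z; rewrite unit_diskE => z1.
  apply/derivable_entriesP; apply: mx_holoD; first exact: mx_holo_cst.
  apply: mx_holoZ; last exact: mx_holo_cst.
  by apply: derivableMc; [exact: derivable_cstc|exact: derivable_idc].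
apply: (near_diag_spectral_ball dr er) => i j; rewrite !mxE.
have := Ae i j; have := Be i j; move: (d i *+ _) (A i j) (B i j) => x a b Hb Ha.
have -> : a + 2 * z * (b - a) - x = (a - x) + 2 * z * ((b - x) - (a - x)) by ring.
apply: le_trans (le_normcD _ _) _.
have H : normc (b - x - (a - x)) <= 3 * e.
  by apply: le_trans (le_normcB _ _) _; lra.
have : normc (2 * z * (b - x - (a - x))) <= 2 * (3 * e).
  rewrite !normcM normc_nat; apply: ler_pM => //.
  - by rewrite mulr_ge0 ?normc_ge0.
  - exact: normc_ge0.
  - by rewrite ler_piMr // ltW.
by move: Ha; lra.
Qed.

End Discs.

(** * Bounds for the Lempert function and the discontinuity *)

Section Lempert.
Variable R : realType.
Local Notation C := R[i].

Lemma lempert_le n (D : set 'M[C]_n) (A B : 'M[C]_n) (phi : C -> 'M[C]_n) (a : C) :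
  normc a < 1 -> holo_disk D phi -> phi 0 = A -> phi a = B ->
  lempert D A B <= normc a.
Proof.
move=> a1 hphi pA pB; apply: ge_inf.
  by exists 0 => _ [b _ <-]; exact: normc_ge0.
by exists a => //; split; [rewrite unit_diskE|exists phi].
Qed.

Lemma le_lempert n (D : set 'M[C]_n) (A B : 'M[C]_n) (c : R) :
  (exists phi (a : C), [/\ normc a < 1, holo_disk D phi, phi 0 = A & phi a = B]) ->
  (forall phi (a : C), normc a < 1 -> holo_disk D phi -> phi 0 = A -> phi a = B ->
    c <= normc a) ->
  c <= lempert D A B.
Proof.
move=> [phi [a [a1 hphi pA pB]]] H; apply: lb_le_inf.
  by exists (normc a); exists a => //; split; [rewrite unit_diskE|exists phi].
by move=> _ [b [b1 [psi [h1 h2 h3]]] <-]; apply: (H psi); rewrite -?unit_diskE.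
Qed.

Lemma holo_disk_conj n (Q : 'M[C]_n) (phi : C -> 'M[C]_n) : Q \in unitmx ->
  holo_disk (spectral_ball R n) phi ->
  holo_disk (spectral_ball R n) (fun z => Q *m phi z *m invmx Q).
Proof.
move=> Qu [dphi bphi]; split=> z z1; last exact: spectral_ball_conj (bphi z z1).
apply/derivable_entriesP; apply: mx_holo_mul; last exact: mx_holo_cst.
apply: mx_holo_mul; first exact: mx_holo_cst.
exact: (derivable_entriesP _ _ _).1 (dphi z z1).
Qed.

Lemma continuous_along_line n (D : set 'M[C]_n) (A M : 'M[C]_n) (f : 'M[C]_n -> R) (e : R) :
  {for A, continuous (f : subspace D -> R)} -> D A -> 0 < e ->
  exists N, forall k, (N <= k)%N -> D (A + k.+1%:R^-1 *: M) ->
    `|f A - f (A + k.+1%:R^-1 *: M)| < e.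
Proof.
move=> cf DA e0.
have : within D (nbhs (A : 'M[C]_n)) [set X | `|f A - f X| < e].
  by rewrite (nbhs_subspace_in DA); have /cvgrPdist_lt := cf; exact.
move=> /nbhs_normP[r r0 H].
(* The norm takes values in [R[i]], and so does the radius; its positivity forces it to be real. *)
have r1 : 0 < Re r by move: r0; rewrite /= ltcE => /andP[].
have rE : r = (Re r)%:C by rewrite RRe_real // gtr0_real.
have [M0 | M0] := eqVneq M 0.
  by exists 0%N => k _ _; rewrite M0 scaler0 addr0 subrr normr0.
pose x := Re `|M|; have xE : `|M| = x%:C by rewrite /x RRe_real // normr_real.
have x0 : 0 <= x by rewrite -ler0c -xE.
exists (Num.bound (x / Re r)) => k Nk Dk; apply: H => //.
rewrite /ball_ /= opprD addrA subrr add0r normrN normrZ xE normc_normrE rE -rmorphM ltcR.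
rewrite normcV normc_nat mulrC ltr_pdivrMr // -ltr_pdivrMl // mulrC.
apply: lt_le_trans (archi_boundP (divr_ge0 x0 (ltW r1))) _.
by rewrite ler_nat (leq_trans Nk).
Qed.

(** The bound [1 / 16] keeps [2 * t] within the radius [8^-1] of the Cauchy estimate; the last bound
    amounts to [K * (2 * t) ^+ 2 <= t * x]. *)
Lemma small_parameter (x K : R) : 0 < x -> 0 < K ->
  exists t : R, [/\ 0 < t, t <= 1 / 16 & 4 * K * t <= x].
Proof.
move=> x0 K0; have K4 : 0 < 4 * K by rewrite mulr_gt0.
exists (Num.min (1 / 16) (x / (4 * K))); split.
- by rewrite lt_min !divr_gt0.
- by rewrite ge_min lexx.
- by rewrite mulrC -ler_pdivlMr // ge_min lexx orbT.
Qed.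

End Lempert.

Theorem theorem1p3 (R : realType) (n : nat) (A : 'M[R[i]]_n)
    (hA : spectral_ball R n A) (hcyc : ~ cyclic_mx A) :
  exists B : 'M[R[i]]_n, spectral_ball R n B /\
    ~ {for A, continuous
        (fun X : subspace (spectral_ball R n) =>
           lempert (spectral_ball R n) X B)}.
Proof.
have [l rkl] : exists l : R[i], (\rank (A - l%:M)%R + 2 <= n)%N.
  apply: derogatory_rank => -[v vu]; apply: hcyc; exists v; exact: krylov_span.
have n2 := leq_trans (leq_addl _ 2) rkl.
case: n => [|[|m]] // in A hA hcyc rkl n2 *.
set n := m.+2 in A hA hcyc rkl n2 *.
have el : eigenvalue A l.
  rewrite /eigenvalue -mxrank_eq0 mxrank_ker subn_eq0 -ltnNge.
  by apply: leq_trans rkl; rewrite addn2.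
pose r : R := 1 - spectral_radius A.
have r0 : 0 < r by rewrite subr_gt0.
have n0 : 0 < n%:R :> R by rewrite ltr0n.
(* [d] will bound the part of the triangular form below the diagonal and be the subdiagonal entry of
   [J]; the 7 is required by [segment_disc]. *)
have [d d0 dr] : exists2 d : R, 0 < d & n%:R * (7 * d) < r.
  exists (r / (8 * n%:R)); first by rewrite divr_gt0 // mulr_gt0.
  have -> : n%:R * (7 * (r / (8 * n%:R))) = (7 / 8) * r by field; rewrite gt_eqF.
  lra.
have [Q Qu [A't A's]] := @small_triangular _ n A d isT d0.
set A' := Q *m A *m invmx Q in A't A's; have A'E : A' = Q *m A *m invmx Q by [].
clearbody A'; have AA' : A = invmx Q *m A' *m invmx (invmx Q).
  by rewrite invmxK A'E -!mulmxA mulVmx // mulmx1 mulKmx.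
have Qiu : invmx Q \in unitmx by rewrite unitmx_inv.
pose a i : R[i] := A' i i; have /is_trig_mxP At0 := A't.
have ar i : normc (a i) <= 1 - r.
  rewrite /r opprB addrC subrK; apply: le_spectral_radius.
  apply: (eigenvalue_conj Qu); rewrite -A'E eigenvalue_root_char /root char_poly_horner.
  rewrite det_trig; first by apply/prodf_eq0; exists i => //; rewrite !mxE eqxx mulr1n subrr.
  apply/is_trig_mxP => j k jk; rewrite !mxE -val_eqE /= (ltn_eqF jk) mulr0n sub0r.
  by rewrite At0 // oppr0.
have la : \prod_i (l - a i) = 0.
  have : \det (l%:M - A') = 0.
    have : eigenvalue A' l.
      by move: el; rewrite AA' => /(eigenvalue_conj Qiu).
    by rewrite eigenvalue_root_char /root char_poly_horner => /eqP.
  rewrite det_trig => [<-|]; first by apply: eq_bigr => i _; rewrite !mxE eqxx mulr1n.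
  apply/is_trig_mxP => j k jk; rewrite !mxE -val_eqE /= (ltn_eqF jk) mulr0n sub0r.
  by rewrite At0 // oppr0.
have l1 : normc l <= 1.
  by apply: ltW; exact: (spectral_ballP A).1 hA l el.
have [K K0 KE] : exists2 K : R, 0 < K & 256 * 2 ^+ n = K.
  exists (256 * 2 ^+ n); last exact: erefl.
  by apply: mulr_gt0; [rewrite ltr0n|apply: exprn_gt0; rewrite ltr0n].
have dn0 : 0 < d ^+ n by exact: exprn_gt0.
have [t [t0 t16 tK]] := small_parameter dn0 K0.
have normd : normc d%:C = d by rewrite normc_real gtr0_norm.
have normt : normc t%:C = t by rewrite normc_real gtr0_norm.
pose J z : 'M[R[i]]_n := bidiag a d%:C (d%:C * z).
have Js z i j : normc z < 1 -> normc (J z i j - a i *+ (i == j)) <= 2 * d.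
  move=> z1; apply: bidiag_entry_le; rewrite ?normcM normd //.
  by rewrite ler_piMr ?(ltW d0) // ltW.
have Jball z : normc z < 1 -> spectral_ball R n (J z).
  move=> z1; apply: (near_diag_spectral_ball ar _ (fun i j => Js z i j z1)).
  apply: le_lt_trans dr; rewrite ler_wpM2l ?(ltW n0) //; lra.
pose conj X := invmx Q *m X *m invmx (invmx Q).
have t1 : normc t%:C < 1 by rewrite normt; lra.
exists (conj (J t%:C)); split; first exact: spectral_ball_conj (Jball _ t1).
(* The tolerance is [t], because the values will be at least [2 * t] at [A] and at most [t] along
   this line. *)
move=> /(@continuous_along_line _ _ (spectral_ball R n) A
  (conj (subdiag _ n)) _ t)/(_ hA t0)[N HN].
have [k Nk [T [Tt T0 AT]]] := @cyclic_perturbation _ m.+1 A' d%:C N A't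
  ltac:(by rewrite -normc_gt0 normd).
have [phi [hphi phi0 phit]] := cyclic_disc t0 Tt T0 AT Jball.
have Ak : A + k.+1%:R^-1 *: conj (subdiag _ n) =
    conj (A' + k.+1%:R^-1 *: subdiag _ n).
  rewrite /conj mulmxDr mulmxDl -scalemxAr -scalemxAl; congr (_ + _).
  exact: AA'.
have Akball : spectral_ball R n (A + k.+1%:R^-1 *: conj (subdiag _ n)).
  rewrite Ak; apply: (spectral_ball_conj Qiu); rewrite -phi0; apply: hphi.2.
  by rewrite unit_diskE normc0.
have upper : lempert (spectral_ball R n) (A + k.+1%:R^-1 *: conj (subdiag _ n))
    (conj (J t%:C)) <= t.
  rewrite -[leRHS]normt; apply: (lempert_le t1 (holo_disk_conj Qiu hphi)).
    by rewrite Ak; exact: (congr1 conj phi0).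
  exact: (congr1 conj phit).
have lower : 2 * t <= lempert (spectral_ball R n) A (conj (J t%:C)).
  apply: le_lempert.
    (* A disc from [A] to the target must exist, lest the infimum be the dummy value 0. *)
    exists (fun z => conj (A' + (2 * z) *: (J t%:C - A'))), (1 / 2)%:C; split.
    - by rewrite normc_real gtr0_norm; lra.
    - apply: (holo_disk_conj Qiu); apply: (segment_disc ar dr) => i j.
        rewrite /a; case: (ltngtP i j) => ij.
        + rewrite At0 // -val_eqE /= (ltn_eqF ij) mulr0n subr0 normc0.
          exact: ltW.
        + by rewrite -val_eqE /= (gtn_eqF ij) mulr0n subr0 A's.
        + by rewrite (val_inj ij) eqxx mulr1n subrr normc0 ltW.
      exact: Js.
    - have E0 : A' + (2 * 0) *: (J t%:C - A') = A' by rewrite mulr0 scale0r addr0.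
      by rewrite [RHS]AA'; exact: (congr1 conj E0).
    - have E1 : A' + (2 * (1 / 2)%:C) *: (J t%:C - A') = J t%:C.
        have -> : 2 * (1 / 2)%:C = 1 :> R[i].
          by rewrite mul1r fmorphV rmorph_nat divff // pnatr_eq0.
        by rewrite scale1r addrC subrK.
      exact: (congr1 conj E1).
  (* If [normc z < 2 * t], the determinant, of modulus [t * d ^+ n], would be at most
     [K * normc z ^+ 2], which is below [K * (2 * t) ^+ 2] and hence below [t * d ^+ n]. *)
  move=> psi z z1 hpsi psi0 psiz; rewrite leNgt; apply/negP => zt.
  have z8 : normc z <= 8^-1.
    by rewrite -[8^-1]mul1r; lra.
  have := disc_det_bound l1 rkl hpsi psi0 psiz z8.
  have -> : \det (l%:M - conj (J t%:C)) = \det (l%:M - J t%:C).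
    have -> : l%:M - conj (J t%:C) = conj (l%:M - J t%:C).
      rewrite /conj mulmxBr mulmxBl; congr (_ - _).
      by rewrite scalar_mxC -mulmxA (mulmxV Qiu) mulmx1.
    have dQ : \det Q != 0 by move: Qu; rewrite unitmxE unitfE.
    by rewrite /conj !det_mulmx !det_inv invrK mulrAC (mulVf dQ) mul1r.
  rewrite det_sub_bidiag //.
  rewrite normcM normd normt KE; apply/negP; rewrite -ltNge.
  have -> : d * t * d ^+ m.+1 = t * d ^+ n by rewrite mulrAC -exprS mulrC.
  have z2 : normc z ^+ 2 < (2 * t) ^+ 2.
    by rewrite !expr2; apply: ltr_pM; rewrite ?normc_ge0.
  have : K * normc z ^+ 2 < K * (2 * t) ^+ 2 by rewrite ltr_pM2l.
  move=> /lt_le_trans; apply.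
  have -> : K * (2 * t) ^+ 2 = t * (4 * K * t) by ring.
  by rewrite ler_wpM2l // ltW.
have := HN k Nk Akball; rewrite ltr_norml => /andP[_].
by move: upper lower; lra.
Qed.
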